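(* Let $n\ge 2$ and $p\in(-\infty,0)\cup(0,1)$. The $p$-affine dual curvature measures form an affine contra-variant family: for every $K\in\mathcal{K}_o^n$, every $\varphi\in\operatorname{SL}(n)$ and every Borel set $\eta\subset S^{n-1}$, $$\mathcal{I}_p(\varphi K,\eta)=\varphi^{-t}\mathcal{I}_p(K,\eta),$$ where $\varphi^{-t}$ is the inverse of the transpose of $\varphi$ and $\varphi^{-t}\mathcal{I}_p(K,\cdot)$ denotes the affine image of the measure $\mathcal{I}_p(K,\cdot)$ under $\varphi^{-t}$.
   Context: A convex body is a compact convex subset of $\mathbb{R}^n$ with nonempty interior; $\mathcal{K}_o^n$ is the set of convex bodies containing the origin in their interiors. For $K\in\mathcal{K}_o^n$, the support function is $h_K(v)=\max\{x\cdot v: x\in K\}$, $v\in S^{n-1}$, and for a compact set $K$ star-shaped with respect to the origin the radial function is $\rho_K(x)=\max\{t\ge 0: tx\in K\}$, $x\in\mathbb{R}^n\setminus\{o\}$. A star body is a compact star-shaped set (with respect to the origin) whose radial function is continuous and positive on $S^{n-1}$. Spherical Lebesgue measure is denoted $du$, $dv$. Affine image of a measure: for a Borel measure $\mu$ on $S^{n-1}$ and $\psi\in\operatorname{SL}(n)$, $\psi\mu(\eta)=\mu(\langle\psi^{-1}\eta\rangle)$ for Borel $\eta\subset S^{n-1}$, where $\langle x\rangle=x/|x|$ for $x\neq o$ and $\langle\psi^{-1}\eta\rangle=\{\langle\psi^{-1}x\rangle:x\in\eta\}$. $L_p$ intersection body: for $p\in(-\infty,0)\cup(0,1)$ and a body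 $K$ (star body, in particular $K\in\mathcal{K}_o^n$), $\mathrm{I}_pK$ is the star body with radial function $$\rho_{\mathrm{I}_pK}(x)=\Big(\frac{1-p}{2}\int_K|x\cdot y|^{-p}\,dy\Big)^{1/p},\qquad x\in\mathbb{R}^n\setminus\{o\}.$$ $q$-cosine transform: for $q>-1$ and $f\in C(S^{n-1})$, $T_qf(u)=\int_{S^{n-1}}f(v)|u\cdot v|^q\,dv$, $u\in S^{n-1}$. Reverse radial Gauss image: for $K\in\mathcal{K}_o^n$ and $\eta\subset S^{n-1}$, $\boldsymbol{\alpha}_K^*(\eta)=\bigcup_{v\in\eta}\{u\in S^{n-1}:\rho_K(u)\,u\cdot v=h_K(v)\}$. $p$-affine dual curvature measure: for $K\in\mathcal{K}_o^n$ and Borel $\eta\subset S^{n-1}$, $$\mathcal{I}_p(K,\eta)=\frac{1-p}{2|p|}\int_{\boldsymbol{\alpha}_K^*(\eta)}\rho_K^{n-p}(v)\,T_{-p}\rho_{\mathrm{I}_pK}^{n-p}(v)\,dv .$$ *)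

(* Defs.v *)
From HB Require Import structures.
From mathcomp Require Import all_boot all_order all_algebra.
From mathcomp Require Import interval_inference.
From mathcomp Require Import all_classical all_reals all_analysis.
From mathcomp Require Import measurable_realfun lra.

Set Implicit Arguments.
Unset Strict Implicit.
Unset Printing Implicit Defensive.
Import Order.TTheory GRing.Theory Num.Theory.
Import numFieldNormedType.Exports.

Local Open Scope classical_set_scope.
Local Open Scope ring_scope.

Definition dot {R : realType} {n : nat} (x y : 'rV[R]_n) : R :=
  \sum_(i < n) x 0 i * y 0 i.

(* The library norm `|x| on 'rV[R]_n is the sup norm. *)
Definition enorm {R : realType} {n : nat} (x : 'rV[R]_n) : R :=
  Num.sqrt (dot x x).

Definition usphere (R : realType) (n : nat) : set 'rV[R]_n :=
  [set u | enorm u = 1].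
Arguments usphere {R n}.

Definition normalize {R : realType} {n : nat} (x : 'rV[R]_n) : 'rV[R]_n :=
  (enorm x)^-1 *: x.

(* The linear map with matrix psi on column vectors, written on rows. *)
Definition lact {R : realType} {n : nat} (psi : 'M[R]_n) (x : 'rV[R]_n) :
  'rV[R]_n := x *m psi^T.

Definition borel_rV (R : realType) (n : nat) :=
  g_sigma_algebraType (@open 'rV[R]_n).

Section borel.
Context {R : realType}.
Implicit Types n : nat.

Let box n (q : {ffun 'I_n -> rat * rat}) : set 'rV[R]_n :=
  [set x | forall i, ratr (q i).1 < x 0 i < ratr (q i).2].

Lemma open_rV_bigcup n (U : set 'rV[R]_n) : open U ->
  U = \bigcup_(q in [set q | box q `<=` U]) box q.
Proof.
move=> oU; apply/seteqP; split => [x Ux|x [q qU]]; last exact: qU.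
have : nbhs x U by exact: open_nbhs_nbhs.
move=> [P xP PU].
have /choice[q qP] (i : 'I_n) : exists q : rat * rat,
    ratr q.1 < x 0 i < ratr q.2 /\
    forall y : R, ratr q.1 < y < ratr q.2 -> P 0 i y.
  have /nbhs_ballP[e /= e0 eP] := xP 0 i.
  have [a] : exists q : rat, x 0 i - e < ratr q < x 0 i.
    have [|q] := @rat_in_itvoo R (x 0 i - e) (x 0 i).
      by rewrite ltrBlDr ltrDl.
    by rewrite in_itv /= => h; exists q.
  move=> /andP[a1 a2].
  have [b] : exists q : rat, x 0 i < ratr q < x 0 i + e.
    have [|q] := @rat_in_itvoo R (x 0 i) (x 0 i + e).
      by rewrite ltrDl.
    by rewrite in_itv /= => h; exists q.
  move=> /andP[b1 b2].
  exists (a, b) => /=; split; first by rewrite a2 b1.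
  move=> y /andP[ay yb]; apply: eP; rewrite /ball /= ltr_norml.
  by apply/andP; split; lra.
exists [ffun i => q i]; last by move=> i; rewrite ffunE; exact: (qP i).1.
move=> y By; apply: PU => i j; rewrite (ord1 i); apply: (qP j).2.
by have := By j; rewrite ffunE.
Qed.

Lemma measurable_fun_rV d (T : measurableType d) n (f : T -> borel_rV R n) :
  (forall i, measurable_fun setT (fun t => (f t : 'rV[R]_n) 0 i)) ->
  measurable_fun setT f.
Proof.
move=> mf; apply: (@measurability _ _ _ (borel_rV R n) setT f (@open 'rV[R]_n)) => // _ [U oU <-].
rewrite setTI (open_rV_bigcup oU) preimage_bigcup.
rewrite bigcup_mkcond; apply: countable_bigcupT_measurable; first exact: countableP.
move=> q; case: ifPn => // _; rewrite (_ : _ @^-1` _ =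
    \bigcap_(i in [set: 'I_n])
      ((fun t => (f t : 'rV[R]_n) 0 i) @^-1` `]ratr (q i).1, ratr (q i).2[)).
  apply: fin_bigcap_measurable => // i _.
  by rewrite -[X in measurable X]setTI; exact: mf.
apply/seteqP; split=> [t tq i _ /=|t tq i]; first by rewrite in_itv/=; exact: tq.
by have := tq i I; rewrite /= in_itv.
Qed.

Lemma measurable_coord n (i : 'I_n) :
  measurable_fun setT (fun x : borel_rV R n => (x : 'rV[R]_n) 0 i).
Proof.
apply: (measurability _ (RGenOpens.measurableE R)).
move=> _ [_ [a [b ->] <-]]; rewrite setTI; apply: sub_sigma_algebra.
by apply: open_comp => [x _|]; [exact: coord_continuous|exact: interval_open].
Qed.

Definition cons_rV n (z : measurableTypeR R * borel_rV R n) :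
  borel_rV R n.+1 := row_mx (z.1)%:M (z.2 : 'rV[R]_n).

Lemma cons_rV0 n (z : measurableTypeR R * borel_rV R n) :
  (cons_rV z : 'rV[R]_n.+1) 0 ord0 = z.1.
Proof.
have := row_mxEl (z.1)%:M (z.2 : 'rV[R]_n) 0 (0 : 'I_1).
by rewrite [in RHS]mxE eqxx mulr1n => <-; congr (row_mx _ _ _ _); exact: val_inj.
Qed.

Lemma cons_rVS n (z : measurableTypeR R * borel_rV R n) (j : 'I_n) :
  (cons_rV z : 'rV[R]_n.+1) 0 (lift ord0 j) = (z.2 : 'rV[R]_n) 0 j.
Proof.
have <- := row_mxEr (z.1)%:M (z.2 : 'rV[R]_n) 0 j.
by congr (row_mx _ _ _ _); exact: val_inj.
Qed.

Lemma measurable_cons_rV n : measurable_fun setT (@cons_rV n).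
Proof.
apply: measurable_fun_rV => i; have [j ->|->] := unliftP ord0 i.
  under eq_fun do rewrite cons_rVS.
  exact: measurableT_comp (@measurable_coord n j) measurable_snd.
under eq_fun do rewrite cons_rV0.
exact: measurable_fst.
Qed.

Lemma measurable_enorm n :
  measurable_fun setT (enorm : borel_rV R n -> R).
Proof.
apply: measurableT_comp.
  by apply: continuous_measurable_fun; exact: sqrt_continuous.
apply: measurable_sum => i; apply: measurable_funM; exact: measurable_coord.
Qed.

Lemma measurable_normalize n :
  measurable_fun setT (normalize : borel_rV R n -> borel_rV R n).
Proof.
apply: measurable_fun_rV => i; under eq_fun do rewrite mxE.
apply: measurable_funM; last exact: measurable_coord.
under eq_fun do rewrite -powR_inv1 ?sqrtr_ge0//.
by apply: (measurableT_comp (measurable_powR _)); exact: measurable_enorm.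
Qed.

End borel.

Fixpoint lebesgue_rV (R : realType) (n : nat) :
    set (borel_rV R n) -> \bar R :=
  match n with
  | 0 => dirac ((0 : 'rV[R]_0) : borel_rV R 0)
  | m.+1 => pushforward (lebesgue_measure \x @lebesgue_rV R m)%E (@cons_rV R m)
  end.

Section lebesgue_rV.
Context {R : realType}.
Implicit Types n : nat.

Section product.
Variables (n : nat) (m : {sigma_finite_measure set (borel_rV R n) -> \bar R}).

Let prod : set (borel_rV R n.+1) -> \bar R :=
  pushforward (lebesgue_measure \x m)%E (@cons_rV R n).

Let prod_measure : {measure set (borel_rV R n.+1) -> \bar R} :=
  measure_function_pushforward__canonical__measure_function_Measure
    (lebesgue_measure \x m)%E (@measurable_cons_rV R n).

HB.instance Definition _ := isMeasure.Build _ _ _ prod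
  (measure0 prod_measure) (measure_ge0 prod_measure)
  (@measure_semi_sigma_additive _ _ _ prod_measure).

Let prod_sigma_finite : sigma_finite setT prod.
Proof.
have /sigma_finiteP[F [TF ndF Foo]] := sigma_finiteT (@lebesgue_measure R).
have /sigma_finiteP[G [TG ndG Goo]] := sigma_finiteT m.
pose hd (x : borel_rV R n.+1) : measurableTypeR R := (x : 'rV[R]_n.+1) 0 ord0.
pose tl (x : borel_rV R n.+1) : borel_rV R n :=
  @rsubmx _ _ 1 n (x : 'rV[R]_n.+1).
have mhd : measurable_fun setT hd by exact: measurable_coord.
have mtl : measurable_fun setT tl.
  apply: measurable_fun_rV => i; under eq_fun do rewrite mxE.
  exact: measurable_coord.
have hdK z : hd (cons_rV z) = z.1 by exact: cons_rV0.
have tlK z : tl (cons_rV z) = z.2 by rewrite /tl /cons_rV row_mxKr.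
exists (fun k => hd @^-1` F k `&` tl @^-1` G k).
  apply/seteqP; split => // x _.
  have [i _ Fi] : (\bigcup_k F k) (hd x) by rewrite -TF.
  have [j _ Gj] : (\bigcup_k G k) (tl x) by rewrite -TG.
  exists (maxn i j) => //; split.
    by have /subsetPset := ndF _ _ (leq_maxl i j); exact.
  by have /subsetPset := ndG _ _ (leq_maxr i j); exact.
move=> k; have [mF Fk] := Foo k; have [mG Gk] := Goo k; split.
  by apply: measurableI; rewrite -[X in measurable X]setTI;
    [exact: mhd|exact: mtl].
have -> : prod (hd @^-1` F k `&` tl @^-1` G k) =
    (lebesgue_measure \x m)%E (F k `*` G k).
  rewrite /prod /pushforward; congr (_ _).
  by apply/seteqP; split=> z /=; rewrite hdK tlK.
by rewrite product_measure1E// lte_mul_pinfty// ge0_fin_numE.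
Qed.

HB.instance Definition _ := Measure_isSigmaFinite.Build _ _ _ prod
  prod_sigma_finite.

Lemma sigma_finite_measure_cons :
  exists m' : {sigma_finite_measure set (borel_rV R n.+1) -> \bar R},
    m' = pushforward (lebesgue_measure \x m)%E (@cons_rV R n) :> (_ -> _).
Proof. by exists prod. Qed.

End product.

Lemma lebesgue_rV_sigma_finite_measure n :
  exists m : {sigma_finite_measure set (borel_rV R n) -> \bar R},
    m = @lebesgue_rV R n :> (_ -> _).
Proof.
elim: n => [|n [m mE]].
  by exists (dirac ((0 : 'rV[R]_0) : borel_rV R 0)).
by have [m' m'E] := sigma_finite_measure_cons m; exists m'; rewrite m'E mE.
Qed.

Section instances.
Variable n : nat.

Let leb0 : @lebesgue_rV R n set0 = 0%E.
Proof.
by have [m <-] := lebesgue_rV_sigma_finite_measure n; exact: measure0.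
Qed.

Let leb_ge0 A : (0 <= @lebesgue_rV R n A)%E.
Proof.
by have [m <-] := lebesgue_rV_sigma_finite_measure n; exact: measure_ge0.
Qed.

Let leb_sigma_additive : semi_sigma_additive (@lebesgue_rV R n).
Proof.
have [m <-] := lebesgue_rV_sigma_finite_measure n.
exact: measure_semi_sigma_additive.
Qed.

HB.instance Definition _ := isMeasure.Build _ _ _ (@lebesgue_rV R n)
  leb0 leb_ge0 leb_sigma_additive.

Let leb_sigma_finite : sigma_finite setT (@lebesgue_rV R n).
Proof.
by have [m <-] := lebesgue_rV_sigma_finite_measure n; exact: sigma_finiteT.
Qed.

HB.instance Definition _ := Measure_isSigmaFinite.Build _ _ _
  (@lebesgue_rV R n) leb_sigma_finite.

End instances.

Definition punctured_ball n : set (borel_rV R n) :=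
  [set x | 0 < enorm x <= 1].

Lemma measurable_punctured_ball n : measurable (@punctured_ball n).
Proof.
rewrite (_ : @punctured_ball n = enorm @^-1` `]0, 1]).
  by rewrite -[X in measurable X]setTI; exact: measurable_enorm.
by apply/seteqP; split => x /=; rewrite in_itv.
Qed.

Lemma lebesgue_rV_box n (A : 'I_n -> set (measurableTypeR R)) :
  (forall i, measurable (A i)) ->
  @lebesgue_rV R n [set x | forall i, A i ((x : 'rV[R]_n) 0 i)] =
  (\prod_(i < n) lebesgue_measure (A i))%E.
Proof.
elim: n A => [|n IHn] A mA.
  rewrite big_ord0 /= diracE mem_set; last by move=> -[].
  by rewrite mulr1n.
rewrite big_ord_recl -IHn//= -product_measure1E//; last first.
  rewrite (_ : [set _ | _] = \bigcap_(i in [set: 'I_n])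
      ((fun x : borel_rV R n => (x : 'rV[R]_n) 0 i) @^-1` A (lift ord0 i))).
    apply: fin_bigcap_measurable => // i _.
    by rewrite -[X in measurable X]setTI; exact: measurable_coord (mA _).
  by apply/seteqP; split=> [x xA i _|x xA i]; [exact: xA|exact: (xA i I)].
rewrite /pushforward; congr (_ _); apply/seteqP; split=> [z zA|z [z1 z2] i].
  split=> /= [|i]; first by have := zA ord0; rewrite cons_rV0.
  by have := zA (lift ord0 i); rewrite cons_rVS.
have [j ->|->] := unliftP ord0 i; first by rewrite cons_rVS; exact: z2.
by rewrite cons_rV0.
Qed.

(* Spherical Lebesgue measure, carried by usphere: n times the Lebesgue measure
   of the cone {t u | u in A, 0 < t <= 1}. *)
Definition sphere_borel n (A : set (borel_rV R n)) : \bar R :=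
  (n%:R%:E * @lebesgue_rV R n
     (normalize @^-1` A `&` @punctured_ball n))%E.

Let sphere_measure n : {measure set (borel_rV R n) -> \bar R} :=
  mscale n%:R%:nng
    (measure_function_pushforward__canonical__measure_function_Measure
       (mrestr (@lebesgue_rV R n) (@measurable_punctured_ball n))
       (@measurable_normalize R n)).

HB.instance Definition _ n := isMeasure.Build _ _ _ (@sphere_borel n)
  (measure0 (sphere_measure n)) (measure_ge0 (sphere_measure n))
  (@measure_semi_sigma_additive _ _ _ (sphere_measure n)).

(* Completed, because the reverse radial Gauss image of a Borel set is Lebesgue
   measurable but not Borel in general. *)
Definition sphere_lebesgue n :=
  @completed_measure_extension _ _ _ (@sphere_borel n).
HB.instance Definition _ n := Measure.on (@sphere_lebesgue n).

End lebesgue_rV.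

Section bodies.
Context {R : realType} {n : nat}.
Implicit Types (K L : set 'rV[R]_n) (p q : R).

Definition convex_body K : Prop :=
  [/\ compact K, convex_set K & K° !=set0].

Definition convex_body_o K : Prop := convex_body K /\ K° 0.

Definition support_fun K (v : 'rV[R]_n) : R := sup [set dot x v | x in K].

Definition radial_fun L (x : 'rV[R]_n) : R :=
  sup [set t : R | 0 <= t /\ L (t *: x)].

(* The star body with radial function f; only f on usphere is used. *)
Definition star_body_of (f : 'rV[R]_n -> R) : set 'rV[R]_n :=
  [set x | exists t u, [/\ usphere u, 0 <= t <= f u & x = t *: u]].

(* In the library powR 0 (- p) = 0 also when 0 < p, where the integrand should be
   +oo; the hyperplane dot x y = 0 is a null set, and so is its trace on the
   sphere in cosine_transform. *)
Definition Lp_intersection_body p K : set 'rV[R]_n :=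
  star_body_of (fun x =>
    ((1 - p) / 2 * \int[@lebesgue_rV R n]_(y in K) (`|dot x y| `^ (- p)))
      `^ p^-1).

Definition cosine_transform q (f : 'rV[R]_n -> R) (u : 'rV[R]_n) : R :=
  \int[@sphere_lebesgue R n]_(v in usphere) (f v * `|dot u v| `^ q).

Definition reverse_radial_gauss_image K (eta : set 'rV[R]_n) : set 'rV[R]_n :=
  \bigcup_(v in eta)
    [set u | usphere u /\ radial_fun K u * dot u v = support_fun K v].

Definition affine_dual_curvature p K (eta : set 'rV[R]_n) : \bar R :=
  (((1 - p) / (2 * `|p|))%:E *
   \int[@sphere_lebesgue R n]_(v in reverse_radial_gauss_image K eta)
     (radial_fun K v `^ (n%:R - p) *
      cosine_transform (- p)
        (fun w => radial_fun (Lp_intersection_body p K) w `^ (n%:R - p)) v)%:E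
  )%E.

Definition affine_image (psi : 'M[R]_n) (mu : set 'rV[R]_n -> \bar R)
    (eta : set 'rV[R]_n) : \bar R :=
  mu [set normalize (lact (invmx psi) x) | x in eta].

End bodies.

(* Main.v *)
Require Import Defs.
From HB Require Import structures.
From mathcomp Require Import all_boot all_order all_algebra.
From mathcomp Require Import all_classical all_reals all_analysis.
From mathcomp Require Import measurable_realfun ring lra.

(* Put [T u = phi u / |phi u|] on the sphere. The support and radial functions
   of [phi K] are those of [K] composed with [phi^T] and [phi^-1], so the reverse
   radial Gauss image of [phi K] at [eta] is the [T]-image of that of [K] at
   [phi^T eta / |phi^T eta|]. Since [det phi = 1], spherical Lebesgue measure
   transforms under [T] with density [|phi u|^-n], and the homogeneity degrees
   cancel it twice: in the cosine transform of [rho_{I_p K}^(n-p)], and again in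
   the integral defining the curvature measure.

   The spherical change of variables comes from the invariance of Lebesgue
   measure under [phi], by polar coordinates. It is needed for functions and
   domains not known to be measurable (the Gauss image in particular): the
   library integral of a nonnegative function is a supremum over the simple
   functions below it, so an inequality between integrals of indicators of
   measurable sets transfers to arbitrary nonnegative functions. *)

Set Implicit Arguments.
Unset Strict Implicit.
Unset Printing Implicit Defensive.
Import Order.TTheory GRing.Theory Num.Theory.
Import numFieldNormedType.Exports.

Local Open Scope classical_set_scope.
Local Open Scope ring_scope.

(** * Integrals of nonnegative, possibly nonmeasurable, functions *)

Section lower_integral.
Local Open Scope ereal_scope.
Context d (T : measurableType d) (R : realType).
Implicit Types (mu : {measure set T -> \bar R}) (D : set T) (f g : T -> \bar R).

Import HBNNSimple.

(** The integral of a nonnegative function is a supremum over the simple functions below it, and a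
    simple function below [f \_ D1] is below [g \_ D2]. *)
Lemma le_integral_ge0 mu D1 D2 f g :
  (forall x, D1 x -> 0 <= f x) -> (forall x, D2 x -> 0 <= g x) ->
  (forall x, (f \_ D1) x <= (g \_ D2) x) ->
  \int[mu]_(x in D1) f x <= \int[mu]_(x in D2) g x.
Proof.
move=> f0 g0 fg; rewrite !ge0_integralE//; apply: ge_ereal_sup => _ [h hf <-].
by apply: ereal_sup_ubound; exists h => // x; exact: le_trans (hf x) (fg x).
Qed.

Lemma integral_le_nnsfun mu D f (M : \bar R) :
  (forall x, D x -> 0 <= f x) ->
  (forall h : {nnsfun T >-> R}, (forall x, (h x)%:E <= (f \_ D) x) ->
    \int[mu]_x (h x)%:E <= M) ->
  \int[mu]_(x in D) f x <= M.
Proof.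
move=> f0 hM; rewrite ge0_integralE//; apply: ge_ereal_sup => _ [h hf <-].
by rewrite -integralT_nnsfun; exact: hM.
Qed.

(** A simple [h] below [f] gives the simple function [c * h] below [c * f], and linearity for simple
    functions is available. Applied with [c^-1] to [c * f], this also yields the opposite
    inequality. *)
Let integralZl_ge mu D f (c : R) : (0 < c)%R -> (forall x, D x -> 0 <= f x) ->
  \int[mu]_(x in D) f x <= (c^-1)%:E * \int[mu]_(x in D) (c%:E * f x).
Proof.
move=> c0 f0; apply: integral_le_nnsfun => // h hf.
have -> : \int[mu]_x (h x)%:E = (c^-1)%:E * \int[mu]_x (c%:E * (h x)%:E).
  rewrite ge0_integralZl//; last 3 first.
  - exact/measurable_EFinP.
  - by move=> x _; rewrite lee_fin.
  - by rewrite lee_fin ltW.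
  by rewrite muleA -EFinM mulVf ?gt_eqF// mul1e.
rewrite lee_pmul2l// ?lte_fin ?invr_gt0//; apply: le_integral_ge0.
- by move=> x _; rewrite mule_ge0// lee_fin// ltW.
- by move=> x Dx; rewrite mule_ge0 ?f0// lee_fin// ltW.
move=> x; rewrite patch_setT; have := hf x; rewrite /patch.
case: ifPn => _ hfx; first by rewrite lee_pmul2l.
by apply: mule_ge0_le0 => //; rewrite lee_fin ltW.
Qed.

Lemma integralZl_ge0 mu D f (c : R) : (0 < c)%R -> (forall x, D x -> 0 <= f x) ->
  \int[mu]_(x in D) (c%:E * f x) = c%:E * \int[mu]_(x in D) f x.
Proof.
move=> c0 f0.
have cf0 x : D x -> 0 <= c%:E * f x.
  by move=> Dx; rewrite mule_ge0 ?f0// lee_fin// ltW.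
apply/eqP; rewrite eq_le; apply/andP; split; last first.
  have := integralZl_ge mu c0 f0.
  rewrite -(@lee_pmul2l _ c%:E)// ?lte_fin// => /le_trans; apply.
  by rewrite muleA -EFinM divff ?gt_eqF// mul1e.
have cV0 : (0 < c^-1)%R by rewrite invr_gt0.
apply: le_trans (integralZl_ge mu cV0 cf0) _; rewrite invrK lee_pmul2l ?lte_fin//.
rewrite le_eqVlt; apply/orP; left; apply/eqP; apply: eq_integral => x _.
by rewrite muleA -EFinM mulVf ?gt_eqF// mul1e.
Qed.

Lemma RintegralZl_ge0 mu D (f : T -> R) (c : R) :
  (0 < c)%R -> (forall x, D x -> 0 <= f x)%R ->
  (\int[mu]_(x in D) (c * f x) = c * \int[mu]_(x in D) f x)%R.
Proof.
move=> c0 f0; rewrite /Rintegral.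
under eq_integral do rewrite EFinM.
rewrite integralZl_ge0//.
have : 0 <= \int[mu]_(x in D) (f x)%:E by apply: integral_ge0.
case: (\int[mu]_(x in D) (f x)%:E) => [r||]//= _.
(* An infinite integral becomes 0 under [fine], before and after scaling by [c > 0]. *)
by rewrite gt0_muley ?lte_fin//= mulr0.
Qed.

End lower_integral.

(** * Transfer of integral inequalities along a map with a Jacobian *)

Section transfer.
Local Open Scope ereal_scope.
Context d1 d2 (X : measurableType d1) (Y : measurableType d2) (R : realType).

Import HBNNSimple.

(** The hypothesis on [mu A] is the change of variables inequality for indicators. Summing it over
    the level sets of a simple [h] below [f \_ D] bounds the integral of [h] by that of
    [J * (h \o T)], which lies below [g \_ E]; only [h], [T] and [J] have to be measurable. *)
Lemma le_integral_transfer (mu : {measure set Y -> \bar R})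
    (nu : {measure set X -> \bar R}) (T : X -> Y) (J : X -> R)
    (D : set Y) (E : set X) (f : Y -> \bar R) (g : X -> \bar R) :
  measurable_fun setT T -> measurable_fun setT J -> (forall x, 0 <= J x)%R ->
  (forall A, measurable A -> mu A <= \int[nu]_x (J x * \1_A (T x))%:E) ->
  (forall y, D y -> 0 <= f y) -> (forall x, E x -> 0 <= g x) ->
  (forall x, (J x)%:E * (f \_ D) (T x) <= (g \_ E) x) ->
  \int[mu]_(y in D) f y <= \int[nu]_(x in E) g x.
Proof.
move=> mT mJ J0 muJ f0 g0 fg; apply: integral_le_nnsfun => // h hf.
rewrite integralT_nnsfun sintegralE.
have m1 r : measurable_fun setT (fun x => (J x * \1_(h @^-1` [set r]) (T x))%:E).
  apply/measurable_EFinP; apply: measurable_funM => //.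
  exact: (measurableT_comp (@measurable_indic _ _ R setT _ _)).
have le1 r : range h r -> r%:E * mu (h @^-1` [set r]) <=
    \int[nu]_x (r%:E * (J x * \1_(h @^-1` [set r]) (T x))%:E).
  move=> [y _ <-]; rewrite ge0_integralZl//.
  - by apply: lee_wpmul2l; [rewrite lee_fin|exact: muJ].
  - by move=> x _; rewrite lee_fin mulr_ge0.
  - by rewrite lee_fin.
apply: le_trans (lee_fsum _ le1) _ => //.
(* The term is nonnegative even for a negative [r]: the indicator is nonzero only if [r = h (T x)],
   and [h] is nonnegative. *)
have t0 r x : 0 <= r%:E * (J x * \1_(h @^-1` [set r]) (T x))%:E.
  rewrite indicE; case: (boolP (T x \in _)) => [|_]; last by rewrite mulr0 mule0.
  by rewrite inE => /= <-; rewrite mulr1 mule_ge0 ?lee_fin.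
rewrite -ge0_integral_fsum//; last first.
  by move=> r; exact: emeasurable_funM.
apply: le_integral_ge0 => // [x _|x]; first exact: fsume_ge0.
rewrite patch_setT; apply: le_trans (fg x).
rewrite (_ : \sum_(_ \in _) _ = (J x)%:E * (h (T x))%:E).
  by apply: lee_wpmul2l; [rewrite lee_fin|exact: hf].
rewrite [in RHS]fimfunE -fsumEFin// ge0_mule_fsumr; last first.
  by move=> r; rewrite EFinM nnfun_muleindic_ge0.
by apply: eq_fsbigr => r _; rewrite -!EFinM mulrCA.
Qed.

End transfer.

(** * Integration against the completion of a finite measure *)

Section completion.
Local Open Scope ereal_scope.
Context d (T : measurableType d) (R : realType).
Variable mu : {measure set T -> \bar R}.
Hypothesis mu_fin : mu setT < +oo.

Notation cmu := (@completed_measure_extension _ _ _ mu).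

Import HBNNSimple.

Lemma completed_measure_extensionE (A : set T) : measurable A -> cmu A = mu A.
Proof. by move=> mA; rewrite /completed_measure_extension measurable_mu_extE. Qed.

(** The outer measure is an infimum over countable measurable covers. Covers within [n.+1%:R^-1] of
    the infimum exist because it is finite, and [C] is the intersection over [n] of their unions. *)
Lemma measurable_hull (A : set T) : exists C,
  [/\ measurable C, A `<=` C & mu C = cmu A].
Proof.
have cA : cmu A \is a fin_num.
  rewrite ge0_fin_numE; last exact: mu_ext_ge0.
  apply: le_lt_trans mu_fin; rewrite -completed_measure_extensionE//.
  exact: le_mu_ext.
have cover (n : nat) : exists F : (set T)^nat,
    [/\ forall k, measurable (F k), A `<=` \bigcup_k F k &
      \sum_(k <oo) mu (F k) < cmu A + n.+1%:R^-1%:E].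
  have n0 : (0 < n.+1%:R^-1 :> R)%R by rewrite invr_gt0.
  have [_ [F [mF AF] <-] lt] := lb_ereal_inf_adherent n0 cA.
  by exists F.
have /choice[F FP] := cover.
have mU n : measurable (\bigcup_k F n k).
  by apply: bigcupT_measurable => k; have [] := FP n.
exists (\bigcap_n \bigcup_k F n k); split.
- exact: bigcapT_measurable.
- by move=> x Ax n _; have [_ AF _] := FP n; exact: AF.
apply/eqP; rewrite eq_le; apply/andP; split; last first.
  rewrite -completed_measure_extensionE; last exact: bigcapT_measurable.
  by apply: le_mu_ext => x Ax n _; have [_ AF _] := FP n; exact: AF.
apply/lee_addgt0Pr => e e0.
have [n ne] : exists n, (n.+1%:R^-1 <= e :> R)%R.
  exists (Num.truncn e^-1); rewrite -[leRHS]invrK lef_pV2 ?posrE ?invr_gt0//.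
  exact/ltW/truncnS_gt.
have [mF AF lt] := FP n.
apply: (@le_trans _ _ (mu (\bigcup_k F n k))).
  apply: le_measure; rewrite ?inE//; first exact: bigcapT_measurable.
  by move=> x; exact.
apply: (@le_trans _ _ (\sum_(k <oo) mu (F n k))).
  exact: measure_sigma_subadditive.
by apply: le_trans (ltW lt) _; rewrite leeD2l// lee_fin.
Qed.

(** The complement of a measurable hull of the complement of [A]; the measures are compared by
    subtracting from the finite total mass. *)
Lemma measurable_kernel (A : set (caratheodory_type (mu^*)%mu)) :
  measurable A -> exists B : set T,
  [/\ measurable B, B `<=` A & mu B = cmu A].
Proof.
move=> mA; have [C [mC AC muC]] := measurable_hull (~` A).
exists (~` C); split; [exact: measurableC| |].
  by move=> x Cx; apply: contrapT => nAx; exact/Cx/AC.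
have finC : mu C \is a fin_num.
  rewrite ge0_fin_numE//; apply: le_lt_trans mu_fin; apply: le_measure;
    by rewrite ?inE.
have muC' : mu C = cmu (~` A) := muC.
have finA : cmu (~` A) \is a fin_num by rewrite -muC'.
(* Both sides are the total mass, split by [C] on the left and by [A] on the right; the second
   summands agree and cancel. *)
have eT : mu (~` C) + mu C = cmu A + cmu (~` A).
  rewrite -measureU//; last 2 first.
  - exact: measurableC.
  - by rewrite setICl.
  rewrite -measureU//; last 2 first.
  - exact: measurableC.
  - by rewrite setICr.
  by rewrite setvU setUv; exact/esym/completed_measure_extensionE.
by rewrite -[LHS](addeK _ finC) eT muC' addeK.
Qed.

(** The identity, typed as a map from the completed sigma-algebra to the original one. *)
Let forget (x : caratheodory_type (mu^*)%mu) : T := x.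

Let measurable_forget :
  measurable_fun setT forget.
Proof.
by move=> _ A mA; rewrite setTI; exact: caratheodory_measurable_mu_ext.
Qed.

(** One inequality is a transfer along the identity. For the other, a simple function for the
    completion is lowered on each level set to a measurable kernel of the same measure: the result
    [g] is measurable for the original sigma-algebra and has the same integral. *)
Lemma integral_completed D (f : T -> \bar R) : (forall x, D x -> 0 <= f x) ->
  \int[cmu]_(x in D) f x = \int[mu]_(x in D) f x.
Proof.
move=> f0; apply/eqP; rewrite eq_le; apply/andP; split; last first.
  apply: (@le_integral_transfer _ _ (caratheodory_type (mu^*)%mu) T R mu cmu
    forget (cst 1%R) D D) => // [A mA|x]; last by rewrite mul1e.
  under eq_integral do rewrite mul1r.
  rewrite (@integral_indic _ _ _ cmu setT measurableT A)//.
    by rewrite setIT -completed_measure_extensionE.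
  exact: caratheodory_measurable_mu_ext.
apply: integral_le_nnsfun => // h hf.
have kern (r : R) : exists B : set T,
    [/\ measurable B, B `<=` h @^-1` [set r] & mu B = cmu (h @^-1` [set r])].
  exact: measurable_kernel.
have /choice[B BP] := kern.
have hE (x : T) : (h x)%:E = \sum_(r \in range h) (r * \1_(h @^-1` [set r]) x)%:E.
  by rewrite {1}fimfunE -fsumEFin.
have mB r : measurable (B r) by have [] := BP r.
have t0 r x : 0 <= (r * \1_(B r) x)%:E.
  rewrite lee_fin indicE; case: (boolP (x \in B r)) => [|_]; last by rewrite mulr0.
  by rewrite inE; have [_ Br _] := BP r => /Br <-; rewrite mulr1.
pose g (x : T) := \sum_(r \in range h) (r * \1_(B r) x)%:E.
have g0 x : 0 <= g x by apply: fsume_ge0.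
apply: (@le_trans _ _ (\int[mu]_x g x)); last first.
  apply: le_integral_ge0 => // x; rewrite patch_setT; apply: le_trans (hf x).
  rewrite hE; apply: lee_fsum => // r [y _ <-].
  rewrite lee_fin ler_wpM2l//; have [_ Br _] := BP (h y).
  by rewrite !indicE ler_nat; case: (boolP (x \in B (h y))) => //;
    rewrite !inE => /Br xr; rewrite mem_set.
rewrite le_eqVlt; apply/orP; left; apply/eqP.
rewrite integralT_nnsfun sintegralE /g ge0_integral_fsum//; last first.
  by move=> r; apply/measurable_EFinP; exact: measurable_funM.
apply: eq_fsbigr => r; rewrite inE => -[y _ <-].
under eq_integral do rewrite EFinM.
rewrite ge0_integralZl//; last 2 first.
- by apply/measurable_EFinP.
- by rewrite lee_fin.
by rewrite integral_indic// setIT; have [_ _ ->] := BP (h y).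
Qed.

End completion.

(** * Lebesgue measure under linear maps *)

Section lebesgue_linear.
Context {R : realType}.
Implicit Types n : nat.

(** The pushforward under [z |-> a * z + b], multiplied by [|a|], gives each interval []x, y]] its
    length, which characterizes Lebesgue measure. *)
Lemma lebesgue_measure_affine (a b : R) (A : set (measurableTypeR R)) :
  a != 0 -> measurable A ->
  lebesgue_measure [set z : measurableTypeR R | A (a * z + b)] =
  ((`|a|^-1)%:E * lebesgue_measure A)%E.
Proof.
move=> a0 mA.
pose f (z : measurableTypeR R) : measurableTypeR R := (a * z + b).
have mf : measurable_fun setT f.
  by apply: measurable_funD => //; apply: measurable_funM.
have na0 : (0 <= `|a|) by [].
pose m : {measure set (measurableTypeR R) -> \bar R} := mscale (NngNum na0)
  (measure_function_pushforward__canonical__measure_function_Measure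
    lebesgue_measure mf).
suff <- : m A = lebesgue_measure A.
  by rewrite /m /mscale /= muleA -EFinM mulVf ?normr_eq0// mul1e.
apply/esym; apply: (@lebesgue_measure_unique _ m) => // _ [[x y] _ <-] /=.
rewrite /m /mscale /= /pushforward.
rewrite lebesgue_measure_itv /= lte_fin.
have [xy|yx] := ltP x y; last first.
  rewrite (_ : f @^-1` _ = set0) ?measure0 ?mule0//.
  by apply/seteqP; split=> // z /=; rewrite in_itv /= => /andP[xf fy]; lra.
have [ap|an] := ltP 0 a.
  rewrite (_ : f @^-1` _ = `]((x - b) / a), ((y - b) / a)]%classic); last first.
    apply/seteqP; split => z /=; rewrite !in_itv /= /f.
      by rewrite ltr_pdivrMr// ler_pdivlMr// => /andP[? ?]; apply/andP; split; lra.
    by rewrite ltr_pdivrMr// ler_pdivlMr// => /andP[? ?]; apply/andP; split; lra.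
  rewrite lebesgue_measure_itv /= lte_fin ltr_pM2r ?invr_gt0// ltrD2r xy.
  by rewrite -!EFinD -EFinM gtr0_norm//; congr EFin; field.
have {}an : (a < 0) by rewrite lt_neqAle a0.
(* A negative slope reverses the order, so the preimage is closed on the left; its length is
   unaffected. *)
rewrite (_ : f @^-1` _ = `[((y - b) / a), ((x - b) / a)[%classic); last first.
  apply/seteqP; split => z /=; rewrite !in_itv /= /f.
    by rewrite ltr_ndivlMr// ler_ndivrMr// => /andP[? ?]; apply/andP; split; lra.
  by rewrite ltr_ndivlMr// ler_ndivrMr// => /andP[? ?]; apply/andP; split; lra.
rewrite lebesgue_measure_itv /= lte_fin ltr_nM2r ?invr_lt0// ltrD2r xy.
by rewrite -!EFinD -EFinM ltr0_norm//; congr EFin; field.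
Qed.

Lemma measurable_mulmx n m (M : 'M[R]_(n, m)) :
  measurable_fun setT (fun x : borel_rV R n => (x : 'rV[R]_n) *m M : borel_rV R m).
Proof.
apply: measurable_fun_rV => i; under eq_fun do rewrite mxE.
apply: measurable_sum => j; apply: measurable_funM => //.
exact: measurable_coord.
Qed.

Lemma measurable_shift n (b : 'rV[R]_n) :
  measurable_fun setT (fun x : borel_rV R n => (x : 'rV[R]_n) + b : borel_rV R n).
Proof.
apply: measurable_fun_rV => i; under eq_fun do rewrite mxE.
by apply: measurable_funD => //; exact: measurable_coord.
Qed.

Lemma lebesgue_rV_fst n (A : set (borel_rV R n.+1)) :
  lebesgue_rV A = (\int[lebesgue_measure]_z
    @lebesgue_rV R n [set y | A (cons_rV (z, y))])%E.
Proof.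
rewrite /= /pushforward /product_measure1; apply: eq_integral => z _ /=.
by congr lebesgue_rV; apply/seteqP; split=> y /=; rewrite /xsection /= inE.
Qed.

(** Tonelli: by uniqueness of the product measure, slices may also be taken along the first
    coordinate, with the others fixed. *)
Lemma lebesgue_rV_snd n (A : set (borel_rV R n.+1)) : measurable A ->
  lebesgue_rV A = (\int[@lebesgue_rV R n]_y
    lebesgue_measure [set z : measurableTypeR R | A (cons_rV (z, y))])%E.
Proof.
move=> mA; rewrite /= /pushforward.
rewrite (@product_measure_unique _ _ _ _ _ lebesgue_measure (@lebesgue_rV R n)
  (lebesgue_measure \x^ @lebesgue_rV R n)%E); last 2 first.
- exact: product_measure2E.
- by rewrite -[X in measurable X]setTI; exact: measurable_cons_rV.
rewrite [LHS]/= /product_measure2; apply: eq_integral => z _ /=.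
by congr lebesgue_measure; apply/seteqP; split=> y /=; rewrite /ysection /= inE.
Qed.

Lemma measurable_cons_preimage1 n (A : set (borel_rV R n.+1)) z :
  measurable A -> measurable [set y : borel_rV R n | A (cons_rV (z, y))].
Proof.
move=> mA; rewrite -[X in measurable X]setTI.
exact: (measurableT_comp (@measurable_cons_rV R n)).
Qed.

Lemma measurable_cons_preimage2 n (A : set (borel_rV R n.+1)) y :
  measurable A -> measurable [set z : measurableTypeR R | A (cons_rV (z, y))].
Proof.
move=> mA; rewrite -[X in measurable X]setTI.
exact: (measurableT_comp (@measurable_cons_rV R n)).
Qed.

Lemma add_cons_rV n (z : R) (y : 'rV[R]_n) (b0 : R) (b : 'rV[R]_n) :
  ((cons_rV (z, y) : 'rV[R]_n.+1) + row_mx (b0%:M : 'M[R]_1) b) =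
  cons_rV ((z + b0), ((y : 'rV[R]_n) + b)).
Proof. by rewrite /cons_rV /= (add_row_mx (z%:M : 'M[R]_1)) -raddfD. Qed.

Lemma mul_cons_rV n (z : R) (y : 'rV[R]_n) (a : R) b c (D : 'M[R]_n) :
  (cons_rV (z, y) : 'rV[R]_n.+1) *m block_mx (a%:M : 'M[R]_1) b c D =
  cons_rV (a * z + (y *m c) 0 0, z *: b + y *m D).
Proof.
transitivity (row_mx (z%:M *m (a%:M : 'M[R]_1) + y *m c) (z%:M *m b + y *m D)).
  exact: (@mul_row_block _ 1 1 n 1 n (z%:M) y a%:M b c D).
rewrite !mul_scalar_mx scale_scalar_mx /cons_rV /= mulrC raddfD /=.
by rewrite -mx11_scalar.
Qed.

(** The vector [b] is split into its first coordinate and the rest. The rest translates each slice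
    with fixed first coordinate, which is the induction hypothesis; the first coordinate translates
    lines. *)
Lemma lebesgue_rV_shift n (b : 'rV[R]_n) (A : set (borel_rV R n)) :
  measurable A ->
  lebesgue_rV [set x : borel_rV R n | A ((x : 'rV[R]_n) + b)] = lebesgue_rV A.
Proof.
elim: n b A => [|n IHn] b A mA.
  congr lebesgue_rV; apply/seteqP; split => x /=;
    by rewrite (thinmx0 (x + b)) (thinmx0 (x : 'rV[R]_0)).
have -> : b = (row_mx (0%:M : 'M[R]_1) (@rsubmx _ _ 1 n b) +
    row_mx ((b 0 0)%:M : 'M[R]_1) 0).
  rewrite (add_row_mx (0%:M : 'M[R]_1)) -raddfD addr0 add0r -[LHS](@hsubmxK _ 1 1 n).
  rewrite [X in row_mx X _](_ : _ = (b 0 0)%:M)//.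
  apply/matrixP => i j; rewrite !ord1 !mxE eqxx mulr1n.
  by congr (b _ _); exact: val_inj.
set b0 := row_mx (0%:M : 'M[R]_1) _; set b1 := row_mx ((b 0 0)%:M : 'M[R]_1) _.
have mA1 : measurable [set x : borel_rV R n.+1 | A ((x : 'rV[R]_n.+1) + b1)].
  by rewrite -[X in measurable X]setTI; exact: measurable_shift.
transitivity (lebesgue_rV [set x : borel_rV R n.+1 | A ((x : 'rV[R]_n.+1) + b1)]).
  rewrite [LHS]lebesgue_rV_fst [RHS]lebesgue_rV_fst; apply: eq_integral => z _.
  rewrite -[RHS](IHn (@rsubmx _ _ 1 n b)); last first.
    exact: measurable_cons_preimage1 mA1.
  congr lebesgue_rV; apply/funext => y /=.
  by rewrite addrA /b0 add_cons_rV addr0.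
rewrite [LHS]lebesgue_rV_snd// [RHS]lebesgue_rV_snd//; apply: eq_integral => y _.
have := @lebesgue_measure_affine 1 (b 0 0) _ (oner_neq0 _)
  (measurable_cons_preimage2 y mA).
rewrite normr1 invr1 mul1e => <-.
congr lebesgue_measure; apply/funext => z /=.
by rewrite /b1 add_cons_rV addr0 mul1r.
Qed.

(** Change of variables as a property of the matrix, closed under products, so that it can be
    checked on triangular factors. The determinant is inverted because a preimage is measured. *)
Definition scales_lebesgue n (M : 'M[R]_n) := forall A : set (borel_rV R n),
  measurable A -> lebesgue_rV [set x : borel_rV R n | A ((x : 'rV[R]_n) *m M)] =
  ((`|\det M|^-1)%:E * lebesgue_rV A)%E.

Lemma scales_lebesgueM n (M N : 'M[R]_n) :
  scales_lebesgue M -> scales_lebesgue N -> scales_lebesgue (M *m N).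
Proof.
move=> sM sN A mA.
have mA' : measurable [set x : borel_rV R n | A ((x : 'rV[R]_n) *m N)].
  by rewrite -[X in measurable X]setTI; exact: measurable_mulmx.
rewrite det_mulmx normrM invfM EFinM -muleA -sN// -sM//.
by congr lebesgue_rV; apply/funext => x /=; rewrite mulmxA.
Qed.

(** For a fixed tail [y], the first coordinate undergoes the affine map [z |-> a * z + y *m c]. *)
Lemma scales_lebesgue_col n (a : R) (c : 'cV[R]_n) : a != 0 ->
  @scales_lebesgue n.+1 (block_mx (a%:M : 'M[R]_1) 0 c 1%:M).
Proof.
move=> a0 A mA.
have mA' : measurable [set x : borel_rV R n.+1 |
    A ((x : 'rV[R]_n.+1) *m block_mx (a%:M : 'M[R]_1) 0 c 1%:M)].
  by rewrite -[X in measurable X]setTI; exact: measurable_mulmx.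
rewrite (det_lblock (a%:M : 'M[R]_1)) det_scalar1 det1 mulr1.
rewrite [LHS]lebesgue_rV_snd// [in RHS]lebesgue_rV_snd//.
rewrite -integralZl_ge0// ?invr_gt0 ?normr_gt0//; apply: eq_integral => y _.
rewrite -(@lebesgue_measure_affine _ (((y : 'rV[R]_n) *m c) 0 0)) //; last first.
  exact: measurable_cons_preimage2.
congr lebesgue_measure; apply/funext => z /=.
by rewrite mul_cons_rV scaler0 add0r mulmx1.
Qed.

(** For a fixed first coordinate [z], the tail undergoes [y |-> z *: b + y *m D], that is, [D]
    composed with a translation. *)
Lemma scales_lebesgue_row n (b : 'rV[R]_n) (D : 'M[R]_n) : scales_lebesgue D ->
  \det D != 0 -> @scales_lebesgue n.+1 (block_mx (1%:M : 'M[R]_1) b 0 D).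
Proof.
move=> sD D0 A mA.
rewrite (det_ublock (1%:M : 'M[R]_1)) det1 mul1r.
rewrite [LHS]lebesgue_rV_fst [in RHS]lebesgue_rV_fst.
rewrite -integralZl_ge0// ?invr_gt0 ?normr_gt0//; apply: eq_integral => z _.
rewrite -sD; last exact: measurable_cons_preimage1.
(* Translating by this vector before applying [D] amounts to adding [z *: b] afterwards. *)
rewrite -[RHS](@lebesgue_rV_shift _ (z *: (b *m invmx D))); last first.
  rewrite -[X in measurable X]setTI; apply: measurable_mulmx => //.
  exact: measurable_cons_preimage1.
congr lebesgue_rV; apply/funext => y /=.
rewrite mul_cons_rV mulmx0 mxE addr0 mul1r.
by rewrite mulmxDl -scalemxAl mulmxKV ?unitmxE ?unitfE// [y *m D + _]addrC.
Qed.

Lemma lebesgue_rV_mulmx n (M : 'M[R]_n) : \det M != 0 -> scales_lebesgue M.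
Proof.
elim: n M => [|n IHn] M M0 A mA.
  rewrite det_mx00 normr1 invr1 mul1e; congr lebesgue_rV.
  by apply/funext => x /=; rewrite (thinmx0 (x *m M)) (thinmx0 (x : 'rV[R]_0)).
(* With a pivot [a], [[a,b],[c,D]] = [[a,0],[c,1]] [[1,b/a],[0,D-cb/a]]; if
   the corner entry vanishes, a transvection first adds a row to the top one. *)
suff pivot (N : 'M[R]_n.+1) : \det N != 0 -> N 0 0 != 0 -> scales_lebesgue N.
  have [M00|M00] := eqVneq (M 0 0) 0; last exact: pivot.
  (* Otherwise the first column would vanish, and expansion along it would give determinant 0. *)
  have [i Mi0] : exists i, M (lift 0 i) 0 != 0.
    apply/existsP; apply: contraNT M0; rewrite negb_exists => /forallP M0.
    rewrite (expand_det_col M 0) big1// => j _.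
    have [k ->|->] := unliftP 0 j; last by rewrite M00 mul0r.
    by have := M0 k; rewrite negbK => /eqP ->; rewrite mul0r.
  pose E : 'M[R]_n.+1 := block_mx (1%:M : 'M[R]_1) (delta_mx 0 i) 0 1%:M.
  have sE : scales_lebesgue E.
    by apply: scales_lebesgue_row; [apply: IHn|]; rewrite det1 oner_neq0.
  have dE : \det E = 1 by rewrite (det_ublock (1%:M : 'M[R]_1)) !det1 mulr1.
  have EM : (E *m M) 0 0 != 0.
    rewrite mxE big_ord_recl M00 mulr0 add0r (bigD1 i)//= big1 ?addr0.
      rewrite (_ : E 0 (lift 0 i) = 1) ?mul1r//.
      transitivity ((delta_mx 0 i : 'rV[R]_n) 0 i); last by rewrite mxE !eqxx.
      rewrite -(@block_mxEur _ 1 n 1 n (1%:M) (delta_mx 0 i) 0 1%:M 0 i).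
      by congr (E _ _); exact: val_inj.
    move=> j ji; rewrite (_ : E 0 (lift 0 j) = 0) ?mul0r//.
    transitivity ((delta_mx 0 i : 'rV[R]_n) 0 j).
      rewrite -(@block_mxEur _ 1 n 1 n (1%:M) (delta_mx 0 i) 0 1%:M 0 j).
      by congr (E _ _); exact: val_inj.
    by rewrite mxE (negbTE ji).
  have mA' : measurable [set x : borel_rV R n.+1 | A ((x : 'rV[R]_n.+1) *m M)].
    by rewrite -[X in measurable X]setTI; exact: measurable_mulmx.
  have := sE _ mA'; rewrite dE normr1 invr1 mul1e => <-.
  have dEM : \det (E *m M) = \det M by rewrite det_mulmx dE mul1r.
  rewrite -dEM -pivot ?dEM//.
  by congr lebesgue_rV; apply/funext => x /=; rewrite mulmxA.
move=> N0 N00; set a := N 0 0.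
pose b := @ursubmx _ 1 n 1 n N; pose c := @dlsubmx _ 1 n 1 n N.
pose D := @drsubmx _ 1 n 1 n N - a^-1 *: (c *m b).
pose P : 'M[R]_n.+1 := block_mx (a%:M : 'M[R]_1) 0 c 1%:M.
pose Q : 'M[R]_n.+1 := block_mx (1%:M : 'M[R]_1) (a^-1 *: b) 0 D.
have NE : N = P *m Q.
  rewrite -[LHS](@submxK _ 1 n 1 n N).
  rewrite /P /Q (@mulmx_block _ 1 n 1 n 1 n).
  rewrite !mul0mx !mulmx0 !addr0 !mulmx1 mul1mx mul_scalar_mx scalerA divff//.
  rewrite scale1r -scalemxAr addrC subrK.
  rewrite (_ : @ulsubmx _ 1 n 1 n N = a%:M)//.
  apply/matrixP => i j; rewrite !ord1 !mxE eqxx mulr1n.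
  by congr (N _ _); exact: val_inj.
have sP : scales_lebesgue P by exact: scales_lebesgue_col.
have D0 : \det D != 0.
  move: N0; rewrite NE det_mulmx (det_ublock (1%:M : 'M[R]_1)) det1 mul1r.
  by apply: contraNneq => ->; rewrite mulr0.
rewrite NE; apply: scales_lebesgueM => //.
by apply: scales_lebesgue_row => //; exact: IHn.
Qed.

End lebesgue_linear.

(** * Euclidean norm, normalization and the linear action *)

Section euclidean.
Context {R : realType}.
Implicit Types n : nat.

Lemma dotC n (x y : 'rV[R]_n) : dot x y = dot y x.
Proof. by apply: eq_bigr => i _; rewrite mulrC. Qed.

Lemma dotE n (x y : 'rV[R]_n) : dot x y = (x *m y^T) 0 0.
Proof. by rewrite mxE; apply: eq_bigr => i _; rewrite mxE. Qed.

Lemma dotZl n (c : R) (x y : 'rV[R]_n) : dot (c *: x) y = c * dot x y.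
Proof. by rewrite !dotE -scalemxAl mxE. Qed.

Lemma dotZr n (c : R) (x y : 'rV[R]_n) : dot x (c *: y) = c * dot x y.
Proof. by rewrite dotC dotZl dotC. Qed.

Lemma dot_lactl n (psi : 'M[R]_n) (x y : 'rV[R]_n) :
  dot (lact psi x) y = dot x (lact psi^T y).
Proof. by rewrite !dotE /lact trmx_mul !trmxK mulmxA. Qed.

Lemma dot_ge0 n (x : 'rV[R]_n) : 0 <= dot x x.
Proof. by apply: sumr_ge0 => i _; rewrite -expr2 sqr_ge0. Qed.

Lemma enorm_ge0 n (x : 'rV[R]_n) : 0 <= enorm x.
Proof. exact: sqrtr_ge0. Qed.

Lemma enormZ n (c : R) (x : 'rV[R]_n) : enorm (c *: x) = `|c| * enorm x.
Proof.
by rewrite /enorm dotZl dotZr mulrA -expr2 sqrtrM ?sqr_ge0// sqrtr_sqr.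
Qed.

Lemma enorm_eq0 n (x : 'rV[R]_n) : (enorm x == 0) = (x == 0).
Proof.
apply/idP/idP => [|/eqP ->]; last first.
  by rewrite -(scale0r (0 : 'rV[R]_n)) enormZ normr0 mul0r.
rewrite /enorm sqrtr_eq0 => d0; apply/eqP/rowP => i; rewrite mxE; apply/eqP.
have : dot x x == 0 by rewrite eq_le d0 dot_ge0.
rewrite psumr_eq0 => [/allP /(_ i)|j _]; last by rewrite -expr2 sqr_ge0.
by rewrite mem_index_enum mulf_eq0 orbb; exact.
Qed.

Lemma enorm_gt0 n (x : 'rV[R]_n) : (0 < enorm x) = (x != 0).
Proof. by rewrite lt_neqAle eq_sym enorm_eq0 enorm_ge0 andbT. Qed.

Lemma le_coord_enorm n (x : 'rV[R]_n) i : `|x 0 i| <= enorm x.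
Proof.
rewrite -(@ler_pXn2r _ 2)// ?nnegrE ?enorm_ge0// sqr_sqrtr ?dot_ge0//.
rewrite real_normK ?num_real// /dot (bigD1 i)//= expr2 lerDl.
by apply: sumr_ge0 => j _; rewrite -expr2 sqr_ge0.
Qed.

Lemma usphere_normalize n (x : 'rV[R]_n) : x != 0 -> usphere (normalize x).
Proof.
move=> x0; rewrite /usphere /normalize /= enormZ ger0_norm ?invr_ge0 ?enorm_ge0//.
by rewrite mulVf// enorm_eq0.
Qed.

Lemma normalizeZ n (c : R) (x : 'rV[R]_n) : 0 < c ->
  normalize (c *: x) = normalize x.
Proof.
move=> c0; rewrite /normalize enormZ gtr0_norm// scalerA invfM.
by rewrite mulrAC mulVf ?mul1r// gt_eqF.
Qed.

Lemma enorm_normalize n (x : 'rV[R]_n) : x = enorm x *: normalize x.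
Proof.
(* At the origin the identity holds because [normalize 0 = 0]. *)
have [->|x0] := eqVneq x 0; first by rewrite /normalize !scaler0.
by rewrite /normalize scalerA divff ?scale1r// enorm_eq0.
Qed.

Lemma normalize_usphere n (u : 'rV[R]_n) : usphere u -> normalize u = u.
Proof. by rewrite /usphere /normalize /= => ->; rewrite invr1 scale1r. Qed.

Lemma usphere_neq0 n (u : 'rV[R]_n) : usphere u -> u != 0.
Proof. by rewrite /usphere /= => u1; rewrite -enorm_eq0 u1 oner_neq0. Qed.

Lemma lactZ n (psi : 'M[R]_n) (c : R) (x : 'rV[R]_n) :
  lact psi (c *: x) = c *: lact psi x.
Proof. by rewrite /lact -scalemxAl. Qed.

Lemma lactM n (psi chi : 'M[R]_n) (x : 'rV[R]_n) :
  lact psi (lact chi x) = lact (psi *m chi) x.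
Proof. by rewrite /lact trmx_mul mulmxA. Qed.

Lemma lact1 n (x : 'rV[R]_n) : lact 1%:M x = x.
Proof. by rewrite /lact trmx1 mulmx1. Qed.

Lemma lactK n (psi : 'M[R]_n) : \det psi = 1 ->
  cancel (lact psi) (lact (invmx psi)).
Proof. by move=> d1 x; rewrite lactM mulVmx ?lact1// unitmxE d1 unitr1. Qed.

Lemma lactVK n (psi : 'M[R]_n) : \det psi = 1 ->
  cancel (lact (invmx psi)) (lact psi).
Proof. by move=> d1 x; rewrite lactM mulmxV ?lact1// unitmxE d1 unitr1. Qed.

Lemma lact_eq0 n (psi : 'M[R]_n) (x : 'rV[R]_n) : \det psi = 1 ->
  (lact psi x == 0) = (x == 0).
Proof.
move=> d1; have l0 (chi : 'M[R]_n) : lact chi 0 = 0 by rewrite /lact mul0mx.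
apply/eqP/eqP => [psix|->]; last exact: l0.
by rewrite -(lactK d1 x) psix l0.
Qed.

Lemma measurable_lact n (psi : 'M[R]_n) :
  measurable_fun setT (lact psi : borel_rV R n -> borel_rV R n).
Proof. exact: measurable_mulmx. Qed.

Lemma measurable_usphere n : measurable (@usphere R n : set (borel_rV R n)).
Proof.
rewrite (_ : usphere = enorm @^-1` [set 1 : R])//.
by rewrite -[X in measurable X]setTI; exact: measurable_enorm.
Qed.

Lemma lebesgue_rV_lact n (psi : 'M[R]_n) (A : set (borel_rV R n)) :
  \det psi = 1 -> measurable A ->
  lebesgue_rV [set x : borel_rV R n | A (lact psi x)] = lebesgue_rV A.
Proof.
move=> d1 mA; rewrite /lact lebesgue_rV_mulmx//.
- by rewrite det_tr d1 normr1 invr1 mul1e.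
- by rewrite det_tr d1 oner_neq0.
Qed.

End euclidean.

(** * Polar coordinates *)

Section polar.
Context {R : realType}.
Implicit Types n : nat.

(** The radial factor of the polar product measure. *)
Definition pos_lebesgue : set (measurableTypeR R) -> \bar R :=
  mrestr lebesgue_measure
    (measurable_itv `]0, +oo[ :
       measurable (`]0, +oo[%classic : set (measurableTypeR R))).

HB.instance Definition _ := Measure.on pos_lebesgue.

Let pos_lebesgue_sigma_finite : sigma_finite setT pos_lebesgue.
Proof.
have [F TF FP] := sigma_finiteT (@lebesgue_measure R).
exists F => // k; have [mF Fk] := FP k; split => //.
apply: le_lt_trans Fk; apply: le_measure; rewrite ?inE//.
exact: measurableI.
Qed.

HB.instance Definition _ := Measure_isSigmaFinite.Build _ _ _
  pos_lebesgue pos_lebesgue_sigma_finite.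

(** The maxima with 0 cut the interval to the positive half-line, and [Num.min a b] makes the
    formula give 0 on empty intervals. *)
Lemma pos_lebesgue_itv (a b : R) : pos_lebesgue `]a, b]%classic =
  (Num.max b 0 - Num.max (Num.min a b) 0)%:E.
Proof.
rewrite /pos_lebesgue /mrestr (_ : _ `&` _ = `]Num.max a 0, b]%classic); last first.
  apply/seteqP; split => x /=; rewrite !in_itv /= andbT gt_max.
    by move=> [/andP[-> ->] ->].
  by move=> /andP[/andP[-> ->] ->].
rewrite lebesgue_measure_itv /= lte_fin.
rewrite !minElt !maxElt; case: ifPn => [|/negP]; rewrite -?EFinB.
  by move=> h; congr EFin; move: h; do !case: ifPn; rewrite -?leNgt; lra.
move=> h; rewrite [RHS](_ : _ = 0%:E)//; congr EFin; move/negP: h; rewrite -leNgt.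
by do !case: ifPn; rewrite -?leNgt; lra.
Qed.

(** The punctured unit ball lies in the cube of side 2. *)
Lemma sphere_borel_lty n : (@sphere_borel R n setT < +oo)%E.
Proof.
rewrite /sphere_borel preimage_setT setTI.
have le1 : (@lebesgue_rV R n (@punctured_ball R n) <=
    \prod_(i < n) lebesgue_measure
      (`[(-1)%R, 1%R]%classic : set (measurableTypeR R)))%E.
  rewrite -lebesgue_rV_box//; apply: le_measure; rewrite ?inE.
  - exact: measurable_punctured_ball.
  - rewrite (_ : [set _ | _] = \bigcap_(i in [set: 'I_n])
      ((fun x : borel_rV R n => (x : 'rV[R]_n) 0 i) @^-1` `[-1, 1]%classic)).
      apply: fin_bigcap_measurable => // i _.
      by rewrite -[X in measurable X]setTI; exact: measurable_coord.
    by apply/seteqP; split=> [x xA i _|x xA i]; [exact: xA|exact: (xA i I)].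
  - move=> x /andP[_ x1] i; rewrite /= in_itv /= -ler_norml.
    exact: le_trans (le_coord_enorm _ _) x1.
apply: (@le_lt_trans _ _ (n%:R%:E * \prod_(i < n) (2%:E : \bar R))%E); last first.
  by rewrite prodEFin -EFinM ltry.
rewrite lee_wpmul2l ?lee_fin//; apply: le_trans le1 _.
rewrite le_eqVlt; apply/orP; left; apply/eqP; apply: eq_bigr => i _.
by rewrite lebesgue_measure_itv /= lte_fin ifT -?EFinB ?opprK//; lra.
Qed.

Lemma sphere_borel_fin_num n (A : set (borel_rV R n)) : measurable A ->
  sphere_borel A \is a fin_num.
Proof.
move=> mA; rewrite ge0_fin_numE//; apply: le_lt_trans (sphere_borel_lty n).
by apply: le_measure; rewrite ?inE.
Qed.

Let sphere_borel_sigma_finite n : sigma_finite setT (@sphere_borel R n).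
Proof.
exists (fun=> setT); first by rewrite bigcup_const.
by move=> _; split => //; exact: sphere_borel_lty.
Qed.

HB.instance Definition _ n := Measure_isSigmaFinite.Build _ _ _
  (@sphere_borel R n) (@sphere_borel_sigma_finite n).

Definition cone n (A : set (borel_rV R n)) : set (borel_rV R n) :=
  normalize @^-1` A `&` [set x | 0 < enorm x].

Lemma measurable_cone n (A : set (borel_rV R n)) : measurable A ->
  measurable (cone A).
Proof.
move=> mA; apply: measurableI.
  by rewrite -[X in measurable X]setTI; exact: measurable_normalize.
rewrite (_ : [set _ | _] = enorm @^-1` `]0, +oo[).
  by rewrite -[X in measurable X]setTI; exact: measurable_enorm.
by apply/seteqP; split => x /=; rewrite in_itv /= andbT.
Qed.

(* The radial coordinate is [|x|^n] rather than [|x|]: its law on a cone is then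
   proportional to Lebesgue measure. *)
Definition enormn n (x : borel_rV R n) : measurableTypeR R := enorm x ^+ n.

Lemma measurable_enormn n : measurable_fun setT (@enormn n).
Proof. by apply: measurable_funX; exact: measurable_enorm. Qed.

Lemma measurable_cone_itv n (A : set (borel_rV R n)) (I : set R) :
  measurable A -> measurable (I : set (measurableTypeR R)) ->
  measurable (cone A `&` @enormn n @^-1` I).
Proof.
move=> mA mI; apply: measurableI; first exact: measurable_cone.
by rewrite -[X in measurable X]setTI; exact: measurable_enormn.
Qed.

(** For [t > 0], the homothety of ratio [t^(1/n)] has determinant [t] and carries the cone truncated
    by the unit ball, which defines [sphere_borel], to the cone truncated at [|x|^n <= t]. *)
Lemma lebesgue_rV_cone n (A : set (borel_rV R n)) (t : R) :
  (0 < n)%N -> measurable A ->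
  (n%:R%:E * lebesgue_rV (cone A `&` @enormn n @^-1` `]-oo, t]) =
   (Num.max t 0)%:E * sphere_borel A)%E.
Proof.
move=> n0 mA; have [t0|t0] := leP t 0.
  rewrite (_ : _ `&` _ = set0) ?measure0 ?mule0 ?mul0e//.
  apply/seteqP; split => // x [[_ /= x0]]; rewrite in_itv /= /enormn => xt.
  by have := lt_le_trans (exprn_gt0 n x0) (le_trans xt t0); rewrite ltxx.
pose s := t `^ (n%:R^-1).
have s0 : 0 < s by exact: powR_gt0.
have sn : s ^+ n = t.
  rewrite -powR_mulrn ?ltW// /s -powRrM mulVf ?pnatr_eq0 ?gtn_eqF//.
  by rewrite powRr1// ltW.
have ds : \det (s%:M : 'M[R]_n) != 0 by rewrite det_scalar expf_neq0// gt_eqF.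
have mC : measurable (cone A `&` @enormn n @^-1` `]-oo, t]).
  by apply: measurable_cone_itv.
have := lebesgue_rV_mulmx ds mC.
rewrite det_scalar sn gtr0_norm// => H.
rewrite /sphere_borel (_ : normalize @^-1` A `&` _ =
    [set x | (cone A `&` @enormn n @^-1` `]-oo, t]) (x *m s%:M)]).
  by rewrite H [RHS]muleCA [X in _ = (_ * X)%E]muleA -EFinM divff ?gt_eqF// mul1e.
apply/funext => x /=; rewrite /cone /= mul_mx_scalar normalizeZ// enormZ.
rewrite gtr0_norm// in_itv /= /enormn enormZ gtr0_norm// exprMn sn.
rewrite pmulr_rgt0// ger_pMr// -[X in (_ <= X)%R](@expr1n R n).
rewrite ler_pXn2r// ?nnegrE ?enorm_ge0//.
by apply/propext; split => [[? /andP[? ?]]|[[? ?] ?]]; repeat split => //;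
  apply/andP.
Qed.

(** Both sides are measures in [I]. The truncated cones determine the left one on half-open
    intervals by subtraction of finite values, and the two measures then agree by uniqueness on the
    generated sigma-algebra. *)
Lemma lebesgue_rV_cone_preimage n (A : set (borel_rV R n))
    (I : set (measurableTypeR R)) :
  (0 < n)%N -> measurable A -> measurable I ->
  (n%:R%:E * lebesgue_rV (cone A `&` @enormn n @^-1` I) =
   sphere_borel A * pos_lebesgue I)%E.
Proof.
move=> n0 mA mI.
have A0 : 0 <= fine (sphere_borel A) by rewrite fine_ge0.
have n0' : 0 <= n%:R :> R by [].
pose m1 : {measure set (measurableTypeR R) -> \bar R} := mscale (NngNum n0')
  (measure_function_pushforward__canonical__measure_function_Measure
    (mrestr (@lebesgue_rV R n) (measurable_cone mA)) (@measurable_enormn n)).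
pose m2 : {measure set (measurableTypeR R) -> \bar R} :=
  mscale (NngNum A0) pos_lebesgue.
have m1E J : m1 J = (n%:R%:E * lebesgue_rV (cone A `&` @enormn n @^-1` J))%E.
  by rewrite /m1 /= /mscale /= /pushforward /mrestr setIC.
have m2E J : m2 J = (sphere_borel A * pos_lebesgue J)%E.
  by rewrite /m2 /= /mscale /= fineK// sphere_borel_fin_num.
rewrite -m1E -m2E.
have m12 (x y : R) : m1 `]x, y]%classic = m2 `]x, y]%classic.
  rewrite m2E pos_lebesgue_itv.
  (* The minimum covers [y < x], where the second interval is empty. *)
  have split_itv : (m1 `]-oo, Num.min x y]%classic + m1 `]x, y]%classic =
      m1 `]-oo, y]%classic)%E.
    rewrite -measureU//; last first.
      apply/seteqP; split => // z /=; rewrite !in_itv /= le_min.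
      by move=> [/andP[zx _] /andP[]]; rewrite ltNge zx.
    apply: (congr1 m1); apply/seteqP; split => z /=; rewrite !in_itv /= le_min.
      by move=> [/andP[]|/andP[]].
    by move=> ->; rewrite andbT; case: (leP z x) => _; [left|right].
  move: split_itv; rewrite ![m1 `]-oo, _]%classic]m1E !lebesgue_rV_cone//.
  rewrite -(fineK (sphere_borel_fin_num mA)); set s := fine _.
  case: (m1 `]x, y]%classic) => [r| |] //; rewrite -!EFinM -?EFinD.
  by move=> -[e]; congr EFin; lra.
apply: (@measure_unique _ R (measurableTypeR R) (@ocitv R)
  (fun k => `](- k%:R), k%:R]%classic)) => //.
- exact: ocitvI.
- by move=> k; exact: is_ocitv.
- exact: bigcup_itvT.
- by move=> _ [[x y] _ <-]; exact: m12.
- move=> k; rewrite m12 m2E pos_lebesgue_itv -(fineK (sphere_borel_fin_num mA)).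
  by rewrite -EFinM ltry.
Qed.

(** The right-hand side is a measure in [F] with the value of the product measure on rectangles, so
    uniqueness of the product measure applies. *)
Lemma polar_coordinates n (F : set (borel_rV R n * measurableTypeR R)) :
  (0 < n)%N -> measurable F ->
  ((@sphere_borel R n \x pos_lebesgue) F =
   n%:R%:E * lebesgue_rV [set x : borel_rV R n |
     (0 < enorm x)%R /\ F (normalize x, enormn x)])%E.
Proof.
move=> n0 mF.
have n0' : 0 <= n%:R :> R by [].
have mT : measurable (setT : set (borel_rV R n)) by [].
pose pol (x : borel_rV R n) : borel_rV R n * measurableTypeR R :=
  (normalize x, enormn x).
have mpol : measurable_fun setT pol.
  apply: measurable_fun_pair; first exact: measurable_normalize.
  exact: measurable_enormn.
pose m : {measure set (borel_rV R n * measurableTypeR R) -> \bar R} :=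
  mscale (NngNum n0')
  (measure_function_pushforward__canonical__measure_function_Measure
    (mrestr (@lebesgue_rV R n) (measurable_cone mT)) mpol).
have mE G : m G = (n%:R%:E * lebesgue_rV [set x : borel_rV R n |
     (0 < enorm x)%R /\ G (normalize x, enormn x)])%E.
  rewrite /m /= /mscale /= /pushforward /mrestr; congr (_ * lebesgue_rV _)%E.
  by apply/seteqP; split => x /=; [move=> [? [_ ?]]|move=> [? ?]].
rewrite -mE; apply: product_measure_unique => // A B mA mB.
rewrite mE -lebesgue_rV_cone_preimage//; congr (_ * lebesgue_rV _)%E.
by apply/seteqP; split => x /=; [move=> [? [? ?]]|move=> [[? ?] ?]].
Qed.

End polar.

(** * Change of variables on the sphere *)

Section sphere_change.
Context {R : realType} {n : nat}.
Implicit Types psi : 'M[R]_n.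

Definition sphere_map psi (u : borel_rV R n) : borel_rV R n :=
  normalize (lact psi u).

(** The Jacobian of [sphere_map psi] on the sphere when [\det psi = 1]. *)
Definition sphere_jac psi (u : borel_rV R n) : R :=
  enorm (lact psi u) `^ (- n%:R).

Lemma measurable_sphere_map psi : measurable_fun setT (sphere_map psi).
Proof.
exact: (measurableT_comp (@measurable_normalize R n) (@measurable_lact R n psi)).
Qed.

Lemma measurable_sphere_jac psi : measurable_fun setT (sphere_jac psi).
Proof.
apply: (measurableT_comp (measurable_powR _)).
exact: (measurableT_comp (@measurable_enorm R n) (@measurable_lact R n psi)).
Qed.

Lemma usphere_sphere_map psi u : \det psi = 1 -> usphere u ->
  usphere (sphere_map psi u).
Proof.
by move=> d1 uS; apply: usphere_normalize; rewrite lact_eq0// usphere_neq0.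
Qed.

Lemma sphere_mapM psi chi u : \det chi = 1 -> usphere u ->
  sphere_map psi (sphere_map chi u) = sphere_map (psi *m chi) u.
Proof.
move=> d1 uS; rewrite /sphere_map -lactM [in RHS](enorm_normalize (lact chi u)).
by rewrite lactZ normalizeZ// enorm_gt0 lact_eq0// usphere_neq0.
Qed.

Lemma sphere_mapK psi u : \det psi = 1 -> usphere u ->
  sphere_map (invmx psi) (sphere_map psi u) = u.
Proof.
move=> d1 uS; rewrite sphere_mapM// mulVmx ?unitmxE ?d1 ?unitr1//.
by rewrite /sphere_map lact1 normalize_usphere.
Qed.

Lemma enorm_lact_normalize psi (x : 'rV[R]_n) :
  enorm (lact psi x) = enorm x * enorm (lact psi (normalize x)).
Proof. by rewrite {1}(enorm_normalize x) lactZ enormZ ger0_norm ?enorm_ge0. Qed.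

Lemma det_invmx1 psi : \det psi = 1 -> \det (invmx psi) = 1.
Proof. by move=> d1; rewrite det_inv d1 invr1. Qed.

(** Makes the Jacobians of [sphere_map psi] and of its inverse reciprocal. *)
Lemma enorm_lact_sphere_map psi u : \det psi = 1 -> usphere u ->
  enorm (lact (invmx psi) (sphere_map psi u)) = (enorm (lact psi u))^-1.
Proof.
move=> d1 uS; rewrite /sphere_map /normalize lactZ lactK// enormZ.
by rewrite (uS : enorm u = 1) mulr1 ger0_norm// invr_ge0 enorm_ge0.
Qed.

(** With radial coordinate [|x|^n], the condition [|x|^n <= |psi u|^-n] in the direction [u] of [x]
    says [|psi x| <= 1]. The subgraph of the integrand thus corresponds to the preimage under [psi]
    of the truncated cone over [A], and [psi] preserves Lebesgue measure. *)
Lemma sphere_borel_change psi (A : set (borel_rV R n)) :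
  (0 < n)%N -> \det psi = 1 -> measurable A ->
  sphere_borel A = (\int[@sphere_borel R n]_u
    (\1_usphere u * sphere_jac psi u * \1_A (sphere_map psi u))%:E)%E.
Proof.
move=> n0 d1 mA.
pose mid u : R := \1_usphere u * sphere_jac psi u * \1_A (sphere_map psi u).
have mmid : measurable_fun setT (mid : borel_rV R n -> R).
  apply: measurable_funM; first apply: measurable_funM.
  - by apply: measurable_indic; exact: measurable_usphere.
  - exact: measurable_sphere_jac.
  - apply: (measurableT_comp (@measurable_indic _ _ R setT _ mA)).
    exact: measurable_sphere_map.
(* The integral is the measure of the subgraph [F] of its integrand. *)
pose F : set (borel_rV R n * measurableTypeR R) :=
  [set z | 0 < z.2 <= mid z.1].
have mF : measurable F.
  rewrite (_ : F = (fun z => (0 < z.2) && (z.2 <= mid z.1)) @^-1` [set true])//.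
  rewrite -[X in measurable X]setTI.
  have : measurable_fun setT (fun z : borel_rV R n * measurableTypeR R =>
      (0 < z.2) && (z.2 <= mid z.1)).
    apply: measurable_and.
      by apply: measurable_fun_ltr => //; exact: measurable_snd.
    apply: measurable_fun_ler; first exact: measurable_snd.
    by apply: measurableT_comp => //; exact: measurable_fst.
  by move=> /(_ measurableT [set true]); exact.
have mid0 u : 0 <= mid u.
  by rewrite /mid mulr_ge0// mulr_ge0// powR_ge0.
transitivity ((@sphere_borel R n \x pos_lebesgue) F)%E; last first.
  rewrite /product_measure1; apply: eq_integral => u _ /=.
  rewrite (_ : xsection F u = `]0, mid u]%classic); last first.
    by apply/seteqP; split => s /=; rewrite /xsection /= in_itv /= inE.
  rewrite pos_lebesgue_itv; congr EFin.
  by rewrite max_l// min_l// maxxx subr0.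
rewrite polar_coordinates// /sphere_borel; congr (_ * _)%E.
have mC : measurable ((normalize @^-1` A : set (borel_rV R n)) `&`
    @punctured_ball R n).
  apply: measurableI; last exact: measurable_punctured_ball.
  by rewrite -[X in measurable X]setTI; exact: measurable_normalize.
rewrite -(lebesgue_rV_lact d1 mC); congr lebesgue_rV.
apply/funext => x /=; apply/propext; rewrite /F /punctured_ball /= /mid.
have [->|x0] := eqVneq x 0.
  have e0 : enorm (0 : 'rV[R]_n) = 0 by apply/eqP; rewrite enorm_eq0.
  by rewrite /lact mul0mx e0 ltxx; split => -[].
have xp : 0 < enorm x by rewrite enorm_gt0.
have nS : usphere (normalize x) by exact: usphere_normalize.
have lp : 0 < enorm (lact psi (normalize x)).
  by rewrite enorm_gt0 lact_eq0// usphere_neq0.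
have -> : normalize (lact psi x) = sphere_map psi (normalize x).
  by rewrite {1}(enorm_normalize x) lactZ normalizeZ.
rewrite (enorm_lact_normalize psi x) mulr_gt0//= exprn_gt0//= xp.
rewrite [\1_usphere _]indicE mem_set// mul1r /sphere_jac.
rewrite powRN powR_mulrn ?enorm_ge0//.
rewrite indicE; have [nA|nA] := pselect (A (sphere_map psi (normalize x))).
  rewrite mem_set// mulr1; set e := enorm (lact psi _) in lp *.
  have -> : (enormn x <= e ^- n) = (enorm x * e <= 1).
    rewrite /enormn -div1r ler_pdivlMr ?exprn_gt0// -exprMn.
    rewrite -[X in (_ <= X) = _](@expr1n R n).
    by rewrite ler_pXn2r// ?nnegrE ?mulr_ge0 ?enorm_ge0.
  by split => -[].
rewrite memNset// mulr0; split => -[] // _.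
by rewrite leNgt exprn_gt0.
Qed.

Lemma integral_sphere_lebesgueE (D : set 'rV[R]_n) (f : 'rV[R]_n -> \bar R) :
  (forall x, D x -> 0 <= f x)%E ->
  (\int[@sphere_lebesgue R n]_(x in D) f x =
   \int[@sphere_borel R n]_(x in D) f x)%E.
Proof. exact: (integral_completed (@sphere_borel_lty R n)). Qed.

Let le_integral_sphere_change psi (D : set 'rV[R]_n) (f : 'rV[R]_n -> R) :
  (0 < n)%N -> \det psi = 1 -> D `<=` usphere -> (forall u, 0 <= f u) ->
  (\int[@sphere_lebesgue R n]_(v in sphere_map psi @` D) (f v)%:E <=
   \int[@sphere_lebesgue R n]_(v in D)
     (sphere_jac psi v * f (sphere_map psi v))%:E)%E.
Proof.
move=> n0 d1 DS f0.
have g0 v : (0 <= (sphere_jac psi v * f (sphere_map psi v))%:E)%E.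
  by rewrite lee_fin mulr_ge0// powR_ge0.
have f0' v : (0 <= (f v)%:E)%E by rewrite lee_fin.
rewrite !integral_sphere_lebesgueE//.
apply: (@le_integral_transfer _ _ _ _ _ _ _ (sphere_map psi)
  (fun u => \1_usphere u * sphere_jac psi u)) => //.
- exact: measurable_sphere_map.
- apply: measurable_funM; last exact: measurable_sphere_jac.
  by apply: measurable_indic; exact: measurable_usphere.
- by move=> u; rewrite mulr_ge0// powR_ge0.
- move=> A mA; rewrite le_eqVlt; apply/orP; left; apply/eqP.
  exact: sphere_borel_change.
move=> u; have [uS|uS] := pselect (usphere u); last first.
  by rewrite /= indicE memNset// mul0r mul0e erestrict_ge0.
rewrite /= indicE mem_set// mul1r /patch.
case: ifPn => [|_]; last by rewrite mule0; case: ifPn.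
(* Injectivity on the sphere: a point with the same image as some [w] in [D] is [w]. *)
rewrite inE => -[w Dw /(congr1 (sphere_map (invmx psi)))].
rewrite !sphere_mapK//; last exact: DS.
by move=> <-; rewrite mem_set.
Qed.

(** The reverse inequality is the one already shown, for the inverse map and the image of [D]; the
    two Jacobians multiply to 1. *)
Lemma integral_sphere_change psi (D : set 'rV[R]_n) (f : 'rV[R]_n -> R) :
  (0 < n)%N -> \det psi = 1 -> D `<=` usphere -> (forall u, 0 <= f u) ->
  (\int[@sphere_lebesgue R n]_(v in sphere_map psi @` D) (f v)%:E =
   \int[@sphere_lebesgue R n]_(v in D)
     (sphere_jac psi v * f (sphere_map psi v))%:E)%E.
Proof.
move=> n0 d1 DS f0; apply/eqP; rewrite eq_le le_integral_sphere_change//=.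
have d1V := det_invmx1 d1.
pose E := sphere_map psi @` D.
have ES : E `<=` usphere.
  by move=> _ [u Du <-]; apply: usphere_sphere_map => //; exact: DS.
have ED : sphere_map (invmx psi) @` E = D.
  apply/seteqP; split => [_ [_ [u Du <-] <-]|u Du].
    by rewrite sphere_mapK//; exact: DS.
  by exists (sphere_map psi u); [exists u|rewrite sphere_mapK//; exact: DS].
rewrite -{1}ED; apply: le_trans (le_integral_sphere_change n0 d1V ES _) _.
  by move=> u; rewrite mulr_ge0// powR_ge0.
rewrite le_eqVlt; apply/orP; left; apply/eqP; apply: eq_integral => v.
rewrite inE => -[u Du <-]; have uS : usphere u by exact: DS.
rewrite sphere_mapK//; congr EFin; rewrite mulrA {1}/sphere_jac.
rewrite enorm_lact_sphere_map// -[RHS]mul1r; congr (_ * _).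
have e0 : 0 < enorm (lact psi u) by rewrite enorm_gt0 lact_eq0// usphere_neq0.
by rewrite /sphere_jac -powRM ?invr_ge0 ?enorm_ge0// mulVf ?gt_eqF// powR1.
Qed.

End sphere_change.

(** * Covariance of the geometric functionals *)

Section covariance.
Context {R : realType}.
Implicit Types n : nat.

Lemma supZ (c : R) (E : set R) : 0 < c -> sup [set c * x | x in E] = c * sup E.
Proof.
have half (d : R) (F : set R) : 0 < d -> has_sup F ->
    has_sup [set d * x | x in F] /\ sup [set d * x | x in F] <= d * sup F.
  move=> d0 supF; have [[x Fx] _] := supF.
  have ub : ubound [set d * x | x in F] (d * sup F).
    move=> _ [y Fy <-]; rewrite ler_pM2l//; exact: sup_upper_bound.
  have ne : [set d * x | x in F] !=set0 by exists (d * x); exists x.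
  by split; [split => //; exists (d * sup F)|exact: ge_sup].
move=> c0; have cV0 : 0 < c^-1 by rewrite invr_gt0.
have EK : [set c^-1 * x | x in [set c * x | x in E]] = E.
  rewrite image_comp -[RHS]image_id; apply: eq_imagel => x _ /=.
  by rewrite mulrA mulVf ?mul1r// gt_eqF.
have [supE|nsupE] := pselect (has_sup E); last first.
  (* If [E] has no supremum, neither has its multiple, and [sup] defaults to 0 for both. *)
  rewrite !sup_out ?mulr0// => /(half _ _ cV0)[]; by rewrite EK.
have [supcE le1] := half _ _ c0 supE; have [_] := half _ _ cV0 supcE.
rewrite EK => le2; apply/eqP; rewrite eq_le le1/=.
by rewrite -(@ler_pM2l _ c^-1)// mulrA mulVf ?mul1r// gt_eqF.
Qed.

Lemma support_fun_lact n (psi : 'M[R]_n) (K : set 'rV[R]_n) v :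
  support_fun [set lact psi x | x in K] v = support_fun K (lact psi^T v).
Proof.
rewrite /support_fun image_comp; congr sup; apply: eq_imagel => x _ /=.
exact: dot_lactl.
Qed.

Lemma support_funZ n (K : set 'rV[R]_n) (c : R) v : 0 < c ->
  support_fun K (c *: v) = c * support_fun K v.
Proof.
move=> c0; rewrite /support_fun -supZ// image_comp; congr sup.
by apply: eq_imagel => x _ /=; rewrite dotZr.
Qed.

Lemma image_lactE n (psi : 'M[R]_n) (K : set 'rV[R]_n) x : \det psi = 1 ->
  [set lact psi y | y in K] x = K (lact (invmx psi) x).
Proof.
move=> d1; apply/propext; split => [[y Ky <-]|Kx]; first by rewrite lactK.
by exists (lact (invmx psi) x) => //; rewrite lactVK.
Qed.

Lemma radial_fun_lact n (psi : 'M[R]_n) (K : set 'rV[R]_n) x : \det psi = 1 ->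
  radial_fun [set lact psi y | y in K] x = radial_fun K (lact (invmx psi) x).
Proof.
move=> d1; rewrite /radial_fun; congr sup; apply/funext => t /=.
by congr (_ /\ _); rewrite -lactZ; exact: image_lactE.
Qed.

Lemma radial_funZ n (K : set 'rV[R]_n) (c : R) x : 0 < c ->
  radial_fun K (c *: x) = c^-1 * radial_fun K x.
Proof.
move=> c0; rewrite /radial_fun -supZ ?invr_gt0//; congr sup.
apply/seteqP; split => [t /= [t0 Kt]|_ /= [t [t0 Kt] <-]].
  exists (c * t); last by rewrite mulrA mulVf ?mul1r// gt_eqF.
  by rewrite mulr_ge0 ?(ltW c0)//; split => //; rewrite mulrC -scalerA.
rewrite mulr_ge0 ?invr_ge0 ?(ltW c0)//; split => //.
by rewrite scalerA mulrAC mulVf ?mul1r// gt_eqF.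
Qed.

Lemma radial_fun_ge0 n (K : set 'rV[R]_n) x : 0 <= radial_fun K x.
Proof.
rewrite /radial_fun; set E := [set t | _].
have [supE|/sup_out -> //] := pselect (has_sup E).
have [[t Et] _] := supE; apply: (@le_trans _ _ t); first by case: Et.
exact: sup_upper_bound.
Qed.

Lemma radial_fun_star_body n (f : 'rV[R]_n -> R) u : usphere u -> 0 <= f u ->
  radial_fun (star_body_of f) u = f u.
Proof.
move=> uS fu; rewrite /radial_fun (_ : [set t | _] = `[0, f u]%classic).
  by rewrite sup_itvcc.
apply/seteqP; split => t /=; rewrite in_itv /=; last first.
  by move=> /andP[t0 tf]; split => //; exists t, u; rewrite t0.
move=> [t0 [s [w [wS /andP[s0 sf] tu]]]]; rewrite t0 /=.
(* Taking norms in [t *: u = s *: w] identifies the radii; the directions then agree unless the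
   radius is 0. *)
have ts : t = s.
  have /(congr1 enorm) := tu.
  by rewrite !enormZ (uS : enorm u = 1) (wS : enorm w = 1) !mulr1 !ger0_norm.
move: tu sf; rewrite ts; have [->//|s0'] := eqVneq s 0.
by move=> /(scalerI s0') ->.
Qed.

(** The contact equation [rho_K(x) (x . y) = h_K(y)] has degree 0 in [x] and degree 1 on both sides
    in [y], so it survives normalizing [phi^-1 u] and [phi^t v], with [psi] for [phi]. *)
Lemma reverse_radial_gauss_image_lact n (psi : 'M[R]_n) (K eta : set 'rV[R]_n) :
  \det psi = 1 -> eta `<=` usphere ->
  reverse_radial_gauss_image [set lact psi x | x in K] eta =
  sphere_map psi @` reverse_radial_gauss_image K
    [set normalize (lact psi^T v) | v in eta].
Proof.
move=> d1 etaS; have d1t : \det psi^T = 1 by rewrite det_tr.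
have d1V := det_invmx1 d1.
have equiv u v : usphere u -> eta v ->
    (radial_fun [set lact psi x | x in K] u * dot u v =
     support_fun [set lact psi x | x in K] v) <->
    (radial_fun K (sphere_map (invmx psi) u) *
       dot (sphere_map (invmx psi) u) (normalize (lact psi^T v)) =
     support_fun K (normalize (lact psi^T v))).
  move=> uS /etaS vS; rewrite radial_fun_lact// support_fun_lact.
  rewrite -{2}(lactVK d1 u) dot_lactl /sphere_map.
  set x := lact (invmx psi) u; set y := lact psi^T v.
  have x0 : 0 < enorm x by rewrite enorm_gt0 lact_eq0// usphere_neq0.
  have y0 : 0 < enorm y by rewrite enorm_gt0 lact_eq0// usphere_neq0.
  rewrite {1 2}(enorm_normalize x) {1 2}(enorm_normalize y).
  rewrite radial_funZ// support_funZ// dotZl dotZr.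
  rewrite mulrACA mulVf ?gt_eqF// mul1r mulrCA.
  split => [|->//]; apply: mulfI; exact: lt0r_neq0.
apply/seteqP; split => [u [v vE [uS eq]]|_ [w [_ [v vE <-] [wS eq]] <-]].
  exists (sphere_map (invmx psi) u); last first.
    by rewrite -{1}(invmxK psi) sphere_mapK.
  exists (normalize (lact psi^T v)); first by exists v.
  by split; [exact: usphere_sphere_map|exact/equiv].
have TwS := usphere_sphere_map d1 wS.
exists v => //; split => //; apply/(equiv _ _ TwS vE).
by rewrite sphere_mapK.
Qed.

(** Transfer with Jacobian 1, once along [psi] and once along its inverse, which handles an
    arbitrary set [K] and an arbitrary nonnegative [f]. *)
Lemma integral_lebesgue_lact n (psi : 'M[R]_n) (K : set 'rV[R]_n)
    (f : 'rV[R]_n -> R) : \det psi = 1 -> (forall x, 0 <= f x) ->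
  (\int[@lebesgue_rV R n]_(y in [set lact psi x | x in K]) (f y)%:E =
   \int[@lebesgue_rV R n]_(x in K) (f (lact psi x))%:E)%E.
Proof.
move=> d1 f0; have f0' x : (0 <= (f x)%:E)%E by rewrite lee_fin.
have half (chi : 'M[R]_n) (D E : set 'rV[R]_n) (g h : 'rV[R]_n -> R) :
    \det chi = 1 -> (forall x, 0 <= g x) -> (forall x, 0 <= h x) ->
    (forall x, D (lact chi x) -> E x) -> (forall x, h x = g (lact chi x)) ->
    (\int[@lebesgue_rV R n]_(y in D) (g y)%:E <=
     \int[@lebesgue_rV R n]_(x in E) (h x)%:E)%E.
  move=> c1 g0 h0 DE hg.
  apply: (@le_integral_transfer _ _ (borel_rV R n) (borel_rV R n) R
    (@lebesgue_rV R n) (@lebesgue_rV R n) (lact chi) (cst 1) D E) => //.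
  - exact: measurable_lact.
  - move=> A mA; have mA' : measurable [set x : borel_rV R n | A (lact chi x)].
      by rewrite -[X in measurable X]setTI; exact: measurable_lact.
    under eq_integral do rewrite mul1r.
    rewrite le_eqVlt; apply/orP; left; apply/eqP.
    transitivity (lebesgue_rV [set x : borel_rV R n | A (lact chi x)]).
      by rewrite lebesgue_rV_lact.
    by rewrite -[X in lebesgue_rV X]setIT -integral_indic.
  - by move=> x _; rewrite lee_fin.
  - by move=> x _; rewrite lee_fin.
  move=> x; rewrite mul1e /patch; case: ifPn => [|_].
    by rewrite inE => /DE Ex; rewrite mem_set// hg.
  by case: ifPn => _; rewrite ?lee_fin.
apply/eqP; rewrite eq_le; apply/andP; split.
  by apply: (half psi) => // x; rewrite image_lactE// lactK.
apply: (half (invmx psi)) => //; first exact: det_invmx1.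
  by move=> x; rewrite image_lactE.
by move=> x; rewrite lactVK.
Qed.

Lemma Rintegral_lebesgue_lact n (psi : 'M[R]_n) (K : set 'rV[R]_n)
    (f : 'rV[R]_n -> R) : \det psi = 1 -> (forall x, 0 <= f x) ->
  \int[@lebesgue_rV R n]_(y in [set lact psi x | x in K]) f y =
  \int[@lebesgue_rV R n]_(x in K) f (lact psi x).
Proof. by move=> d1 f0; congr fine; exact: integral_lebesgue_lact. Qed.

(** * The intersection body and its cosine transform under linear maps *)

Section fixed_p.
Variable p : R.
Hypothesis p01 : p < 0 \/ 0 < p < 1.

Let p_neq0 : p != 0.
Proof. by case: p01 => [|/andP[+ _]]; [exact: ltr0_neq0|exact: lt0r_neq0]. Qed.

Let p_lt1 : p < 1.
Proof. by case: p01 => [p0|/andP[]//]; exact: lt_trans ltr01. Qed.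

(* [Lp_intersection_body] uses this function on the sphere only; it is the
   radial function, extended to the whole space by homogeneity. *)
Definition Lp_radial n (K : set 'rV[R]_n) (x : 'rV[R]_n) : R :=
  ((1 - p) / 2 * \int[@lebesgue_rV R n]_(y in K) (`|dot x y| `^ (- p)))
  `^ p^-1.

Lemma radial_fun_Lp_intersection_body n (K : set 'rV[R]_n) u : usphere u ->
  radial_fun (Lp_intersection_body p K) u = Lp_radial K u.
Proof. by move=> uS; rewrite radial_fun_star_body// powR_ge0. Qed.

Lemma Lp_radial_lact n (psi : 'M[R]_n) (K : set 'rV[R]_n) x : \det psi = 1 ->
  Lp_radial [set lact psi y | y in K] x = Lp_radial K (lact psi^T x).
Proof.
move=> d1; rewrite /Lp_radial.
rewrite (Rintegral_lebesgue_lact K (f := fun y => `|dot x y| `^ (- p)) d1).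
  by under eq_Rintegral do rewrite dotC dot_lactl dotC.
by move=> y; exact: powR_ge0.
Qed.

Lemma Lp_radialZ n (K : set 'rV[R]_n) (c : R) x : 0 < c ->
  Lp_radial K (c *: x) = c^-1 * Lp_radial K x.
Proof.
move=> c0; rewrite /Lp_radial.
under eq_Rintegral do rewrite dotZl normrM (gtr0_norm c0) powRM ?(ltW c0)//.
rewrite RintegralZl_ge0 ?powR_gt0//.
have p2 : 0 <= (1 - p) / 2 by rewrite divr_ge0// subr_ge0 ltW.
rewrite mulrCA powRM ?powR_ge0//; last first.
  by rewrite mulr_ge0//; apply: Rintegral_ge0 => y _; exact: powR_ge0.
(* The integral contributes [c^(-p)], and the outer exponent [1/p] turns it into [c^-1]. *)
by rewrite -powRrM mulNr divff// powR_inv1 ?ltW.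
Qed.

(** The exponents of [e] add up to [-n + (n - p) + p = 0]: the Jacobian, the power [n - p] of a
    radial function of degree -1, and a factor of degree [-p], the last two evaluated at a point
    scaled by [e^-1]. *)
Lemma powR_jacobian (n : nat) (e a b : R) : 0 < e -> 0 <= a ->
  e `^ (- n%:R) * ((e * a) `^ (n%:R - p) * (e^-1 `^ (- p) * b)) =
  a `^ (n%:R - p) * b.
Proof.
move=> e0 a0; rewrite powRM ?(ltW e0)//.
have -> : e^-1 `^ (- p) = e `^ p.
  by rewrite -powR_inv1 ?(ltW e0)// -powRrM mulrNN mul1r.
rewrite (_ : _ * _ = e `^ (- n%:R) * e `^ (n%:R - p) * e `^ p *
  (a `^ (n%:R - p) * b)); last by ring.
rewrite -!powRD ?(gt_eqF e0) ?implybT//.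
by rewrite (_ : - n%:R + (n%:R - p) + p = 0) ?powRr0 ?mul1r//; ring.
Qed.

Definition Lp_cosine n (K : set 'rV[R]_n) (u : 'rV[R]_n) : R :=
  cosine_transform (- p)
    (fun w => radial_fun (Lp_intersection_body p K) w `^ (n%:R - p)) u.

Lemma Lp_cosineE n (K : set 'rV[R]_n) u : Lp_cosine K u =
  \int[@sphere_lebesgue R n]_(v in usphere)
    (Lp_radial K v `^ (n%:R - p) * `|dot u v| `^ (- p)).
Proof.
apply: eq_Rintegral => v; rewrite inE => vS.
by rewrite radial_fun_Lp_intersection_body.
Qed.

Lemma Lp_cosine_ge0 n (K : set 'rV[R]_n) u : 0 <= Lp_cosine K u.
Proof. by apply: Rintegral_ge0 => v _; rewrite mulr_ge0 ?powR_ge0. Qed.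

Lemma Lp_cosineZ n (K : set 'rV[R]_n) (c : R) u : 0 < c ->
  Lp_cosine K (c *: u) = c `^ (- p) * Lp_cosine K u.
Proof.
move=> c0; rewrite !Lp_cosineE -RintegralZl_ge0 ?powR_gt0//; last first.
  by move=> v _; rewrite mulr_ge0 ?powR_ge0.
apply: eq_Rintegral => v _.
by rewrite dotZl normrM (gtr0_norm c0) powRM ?(ltW c0)// mulrCA.
Qed.

(** Substitute [v = chi w / |chi w|] with [chi] the inverse transpose of [psi]. Then [psi^T] sends
    [v] to [w / |chi w|], while [u . chi w] equals [psi^-1 u . w]; the powers of [|chi w|] cancel
    against the Jacobian. *)
Lemma Lp_cosine_lact n (psi : 'M[R]_n) (K : set 'rV[R]_n) u :
  (0 < n)%N -> \det psi = 1 ->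
  Lp_cosine [set lact psi x | x in K] u = Lp_cosine K (lact (invmx psi) u).
Proof.
move=> n0 d1; have d1t : \det psi^T = 1 by rewrite det_tr.
have d1V := det_invmx1 d1t; pose chi := invmx psi^T.
have -> : Lp_cosine K (lact (invmx psi) u) = Lp_cosine K (lact chi^T u).
  by rewrite /chi trmx_inv trmxK.
have chiS : sphere_map chi @` usphere = (usphere : set 'rV[R]_n).
  apply/seteqP; split => [_ [v vS <-]|v vS]; first exact: usphere_sphere_map.
  exists (sphere_map psi^T v); first exact: usphere_sphere_map.
  exact: sphere_mapK.
rewrite !Lp_cosineE /Rintegral -{1}chiS integral_sphere_change//; last first.
  by move=> v; rewrite mulr_ge0 ?powR_ge0.
congr fine; apply: eq_integral => v; rewrite inE => vS; congr EFin.
rewrite Lp_radial_lact//; set e := enorm (lact chi v).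
have e0 : 0 < e by rewrite enorm_gt0 lact_eq0// usphere_neq0.
have -> : lact psi^T (sphere_map chi v) = e^-1 *: v.
  by rewrite /sphere_map /normalize lactZ lactVK.
rewrite Lp_radialZ ?invr_gt0// invrK dotC /sphere_map /normalize dotZl dot_lactl.
rewrite normrM (gtr0_norm (_ : 0 < e^-1)) ?invr_gt0//.
rewrite [(e^-1 * _) `^ _]powRM ?invr_ge0 ?(ltW e0)//.
rewrite /sphere_jac -/e [dot v _]dotC.
by apply: powR_jacobian => //; exact: powR_ge0.
Qed.

End fixed_p.

End covariance.

(** * Contravariance of the affine dual curvature measures *)

Theorem proposition1 (R : realType) (n : nat) (p : R) (K : set 'rV[R]_n)
    (phi : 'M[R]_n) (eta : set 'rV[R]_n) :
  (2 <= n)%N ->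
  p < 0 \/ 0 < p < 1 ->
  convex_body_o K ->
  \det phi = 1 ->
  measurable (eta : set (borel_rV R n)) ->
  eta `<=` usphere ->
  affine_dual_curvature p [set lact phi x | x in K] eta =
  affine_image (invmx phi^T) (affine_dual_curvature p K) eta.
Proof.
move=> n2 p01 _ d1 _ etaS; have n0 : (0 < n)%N by exact: ltnW.
(* The affine image under [phi^-t] pulls [eta] back by [phi^t], the set at which the Gauss image of
   [K] is taken. *)
rewrite /affine_image invmxK /affine_dual_curvature.
apply: (congr1 (mule ((1 - p) / (2 * `|p|))%:E)).
rewrite (reverse_radial_gauss_image_lact K d1 etaS).
set D := reverse_radial_gauss_image K _.
have DS : D `<=` usphere by move=> u [v _ []].
pose L := [set lact phi x | x in K].
have f0 u : 0 <= radial_fun L u `^ (n%:R - p) * Lp_cosine p L u.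
  by rewrite mulr_ge0 ?powR_ge0 ?Lp_cosine_ge0.
apply: etrans (integral_sphere_change n0 d1 DS f0) _.
apply: eq_integral => w; rewrite inE => /DS wS.
rewrite -/(Lp_cosine p K w); apply: (congr1 EFin).
rewrite /L (Lp_cosine_lact p01 K _ n0 d1).
rewrite radial_fun_lact; last exact: d1.
set e := enorm (lact phi w).
have e0 : 0 < e by rewrite enorm_gt0 lact_eq0// usphere_neq0.
(* After the substitution, the radial function and the cosine transform of [K] are both evaluated at
   [w / |phi w|]; their degrees -1 and [-p] produce the powers of [e] that cancel the Jacobian. *)
have -> : lact (invmx phi) (sphere_map phi w) = e^-1 *: w.
  by rewrite /sphere_map /normalize lactZ lactK.
rewrite radial_funZ ?Lp_cosineZ ?invr_gt0// invrK.
rewrite /sphere_jac -/e.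
by apply: powR_jacobian => //; exact: radial_fun_ge0.
Qed.
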